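(* Let $f:\mathcal{C}\to\mathcal{D}$ be a functor between conventional categories, equipped with subcategories $W_{\mathcal{C}}\subset\mathcal{C}$ and $W_{\mathcal{D}}\subset\mathcal{D}$. Let $\mathcal{C}'$ and $\mathcal{D}'$ be their $\infty$-localizations with respect to $W_{\mathcal{C}}$ and $W_{\mathcal{D}}$, and let $\mathrm{Ho}(\mathcal{C}'),\mathrm{Ho}(\mathcal{D}')$ be the conventional truncations of these, obtained by applying the functor $\pi_0$ to all function spaces. Assume that $f':\mathcal{C}'\to\mathcal{D}'$ is a left derived functor of $f$. Then the induced conventional functor $\mathrm{Ho}(f'):\mathrm{Ho}(\mathcal{C}')\to\mathrm{Ho}(\mathcal{D}')$ is a left derived functor of $f$ in the conventional setting.
   Context: ''Conventional category'' means ordinary (1-)category. $\infty$-localization: for a category $\mathcal{C}$ and a subcategory $W\subset\mathcal{C}$ containing all equivalences, $\mathcal{C}\to\mathcal{C}[W^{-1}]$ is the initial object among functors to $\infty$-categories carrying all arrows of $W$ to equivalences. Conventional localization is defined by the same universal property among conventional categories. For a functor $f:\mathcal{C}\to\mathcal{D}$ let $\mathcal{E}_f=(\mathcal{C}\times[1])\sqcup^{\mathcal{C}}\mathcal{D}\to[1]$ be the cocartesian fibration classified by $f$ (fibers $\mathcal{C}$ over $0$, $\mathcal{D}$ over $1$), and let $\mathcal{E}'_f$ be its localization with respect to $W_{\mathcal{C}}\cup W_{\mathcal{D}}$. If $\mathcal{E}'_f\to[1]$ is a cocartesian fibration, the left derived functor of $f$ is the functor $\mathcal{C}'\to\mathcal{D}'$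 classifying $\mathcal{E}'_f$. In the $\infty$-setting all localizations are $\infty$-localizations; ''left derived functor in the conventional setting'' is the same definition with all localizations (of $\mathcal{C}$, $\mathcal{D}$ and $\mathcal{E}_f$) taken in the conventional sense. *)

(* Defs.v *)
From Stdlib Require Import Relations.
From mathcomp Require Import all_boot zify.
From mathcomp Require Import boolp.

Set Implicit Arguments.
Unset Strict Implicit.
Unset Printing Implicit Defensive.

(** [cmp v u] is [v] after [u].  All categories and simplicial sets are small
    with respect to one fixed universe. *)

Record category := Category {
  ob :> Type;
  hom : ob -> ob -> Type;
  idm : forall x, hom x x;
  cmp : forall x y z, hom y z -> hom x y -> hom x z;
  cmp1m : forall x y (u : hom x y), cmp (idm y) u = u;
  cmpm1 : forall x y (u : hom x y), cmp u (idm x) = u;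
  cmpA : forall x y z t (w : hom z t) (v : hom y z) (u : hom x y),
    cmp w (cmp v u) = cmp (cmp w v) u }.

Arguments hom {c} x y.
Arguments idm {c} x.
Arguments cmp {c x y z} v u.

Definition is_iso (C : category) (x y : C) (u : hom x y) : Prop :=
  exists v : hom y x, cmp v u = idm x /\ cmp u v = idm y.

Record functor (C D : category) := Functor {
  fob :> C -> D;
  fmap : forall x y, hom x y -> hom (fob x) (fob y);
  fmap1 : forall x, fmap (idm x) = idm (fob x);
  fmapM : forall x y z (v : hom y z) (u : hom x y),
    fmap (cmp v u) = cmp (fmap v) (fmap u) }.

Arguments fmap {C D} f {x y} u.

Definition hcast (C : category) (x x' y y' : C) (ex : x = x') (ey : y = y')
    (u : hom x y) : hom x' y' :=
  let: erefl := ex in let: erefl := ey in u.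

Lemma hcast_id (C : category) (x y : C) (ex : x = x) (ey : y = y)
    (u : hom x y) : hcast ex ey u = u.
Proof. by rewrite (Prop_irrelevance ex erefl) (Prop_irrelevance ey erefl). Qed.

Lemma functor_ext (C D : category) (F G : functor C D) :
  (forall x, F x = G x) ->
  (forall x y (u : hom x y) ex ey, hcast ex ey (fmap F u) = fmap G u) -> F = G.
Proof.
case: F => f fm f1 fM; case: G => g gm g1 gM /= e.
have fg : f = g by apply: functional_extensionality_dep.
case: _ / fg in gm g1 gM e * => h.
have fgm : fm = gm.
  do 3!(apply: functional_extensionality_dep => ?).
  by rewrite -(h _ _ _ erefl erefl).
case: _ / fgm in g1 gM h *.
by rewrite (Prop_irrelevance f1 g1) (Prop_irrelevance fM gM).
Qed.

Definition fid (C : category) : functor C C :=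
  @Functor C C id (fun _ _ u => u) (fun _ => erefl) (fun _ _ _ _ _ => erefl).

Program Definition fcomp (A B C : category) (G : functor B C)
    (F : functor A B) : functor A C :=
  @Functor A C (fun x => G (F x)) (fun _ _ u => fmap G (fmap F u)) _ _.
Next Obligation. by rewrite !fmap1. Qed.
Next Obligation. by rewrite !fmapM. Qed.

Record nattrans (C D : category) (F G : functor C D) := NatTrans {
  component :> forall x, hom (F x) (G x);
  naturality : forall x y (u : hom x y),
    cmp (component y) (fmap F u) = cmp (fmap G u) (component x) }.

Record natiso (C D : category) (F G : functor C D) := NatIso {
  natiso_trans :> nattrans F G;
  natiso_iso : forall x, is_iso (natiso_trans x) }.

Lemma natiso_ext (C D : category) (F G : functor C D) (a b : natiso F G) :
  (forall x, a x = b x) -> a = b.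
Proof.
case: a b => [[a na] ia] [[b nb] ib] /= h.
have ab : a = b by apply: functional_extensionality_dep.
case: _ / ab in nb ib h *.
have nab := Prop_irrelevance na nb; case: _ / nab in ib *.
by rewrite (Prop_irrelevance ia ib).
Qed.

Lemma is_iso_id (C : category) (x : C) : is_iso (idm x).
Proof. by exists (idm x); rewrite cmp1m. Qed.

Lemma is_iso_cmp (C : category) (x y z : C) (v : hom y z) (u : hom x y) :
  is_iso v -> is_iso u -> is_iso (cmp v u).
Proof.
move=> [v' [v1 v2]] [u' [u1 u2]]; exists (cmp u' v'); split.
  by rewrite cmpA -(cmpA u') v1 cmpm1.
by rewrite cmpA -(cmpA v) u2 cmpm1.
Qed.

Lemma is_iso_fmap (C D : category) (F : functor C D) (x y : C) (u : hom x y) :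
  is_iso u -> is_iso (fmap F u).
Proof. by move=> [v [h k]]; exists (fmap F v); rewrite -!fmapM h k !fmap1. Qed.

Program Definition natiso_id (C D : category) (F : functor C D) : natiso F F :=
  @NatIso _ _ _ _ (@NatTrans _ _ F F (fun x => idm (F x)) _) _.
Next Obligation. by rewrite cmp1m cmpm1. Qed.
Next Obligation. exact: is_iso_id. Qed.

Program Definition natiso_cmp (C D : category) (F G H : functor C D)
    (b : natiso G H) (a : natiso F G) : natiso F H :=
  @NatIso _ _ _ _ (@NatTrans _ _ F H (fun x => cmp (b x) (a x)) _) _.
Next Obligation. by rewrite -cmpA naturality cmpA naturality -cmpA. Qed.
Next Obligation. by apply: is_iso_cmp; apply: natiso_iso. Qed.

(** The maximal groupoid in the category of functors from [A] to [B]. *)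
Program Definition fun_core (A B : category) : category :=
  @Category (functor A B) (@natiso A B) (@natiso_id A B) (@natiso_cmp A B)
    _ _ _.
Next Obligation. by apply: natiso_ext => z /=; rewrite cmp1m. Qed.
Next Obligation. by apply: natiso_ext => z /=; rewrite cmpm1. Qed.
Next Obligation. by apply: natiso_ext => s /=; rewrite cmpA. Qed.

Program Definition full_subcat (C : category) (P : C -> Prop) : category :=
  @Category {x : C | P x} (fun x y => hom (sval x) (sval y))
    (fun x => idm (sval x)) (fun _ _ _ v u => cmp v u) _ _ _.
Next Obligation. exact: cmp1m. Qed.
Next Obligation. exact: cmpm1. Qed.
Next Obligation. exact: cmpA. Qed.

Definition full_incl (C : category) (P : C -> Prop) :
    functor (full_subcat P) C :=
  @Functor (full_subcat P) C sval (fun _ _ u => u)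
    (fun _ => erefl) (fun _ _ _ _ _ => erefl).

Definition cat_equivalence (C D : category) (F : functor C D) : Prop :=
  exists G : functor D C,
    inhabited (natiso (fcomp G F) (fid C)) /\
    inhabited (natiso (fcomp F G) (fid D)).

(** A subcategory containing all isomorphisms; in particular it contains all
    identities, hence all objects. *)
Record subcat (C : category) := Subcat {
  in_subcat :> forall x y : C, hom x y -> Prop;
  subcat_cmp : forall x y z (v : hom y z) (u : hom x y),
    in_subcat v -> in_subcat u -> in_subcat (cmp v u);
  subcat_iso : forall x y (u : hom x y), is_iso u -> in_subcat u }.

Arguments in_subcat {C} s {x y} u.

Definition inverts (C : category) (W : subcat C) (D : category)
    (F : functor C D) : Prop :=
  forall (x y : C) (u : hom x y), W x y u -> is_iso (fmap F u).

Section CatPrecomposition.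
Variables (C C' : category) (W : subcat C) (L : functor C C').
Hypothesis LW : inverts W L.

Lemma inverts_fcomp (D : category) (F : functor C' D) : inverts W (fcomp F L).
Proof. by move=> x y u /LW; apply: is_iso_fmap. Qed.

Program Definition whisker (D : category) (F G : functor C' D)
    (a : natiso F G) : natiso (fcomp F L) (fcomp G L) :=
  @NatIso _ _ _ _ (@NatTrans _ _ (fcomp F L) (fcomp G L) (fun x => a (L x)) _) _.
Next Obligation. exact: naturality. Qed.
Next Obligation. exact: natiso_iso. Qed.

Program Definition cat_precomp (D : category) :
    functor (fun_core C' D) (full_subcat (C := fun_core C D) (@inverts C W D)) :=
  @Functor (fun_core C' D) (full_subcat (C := fun_core C D) (@inverts C W D))
    (fun F => exist _ (fcomp F L) (inverts_fcomp F))
    (fun F G a => whisker a) _ _.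
Next Obligation. exact: natiso_ext. Qed.
Next Obligation. exact: natiso_ext. Qed.

End CatPrecomposition.

(** [L] is initial, in the (2,1)-category of categories under [C], among the
    functors that send [W] to isomorphisms: for every [D] the groupoid of
    functors from [C'] to [D] is equivalent, by precomposition with [L], to the
    groupoid of functors from [C] to [D] inverting [W]. *)
Definition localization (C : category) (W : subcat C) (C' : category)
    (L : functor C C') : Prop :=
  exists LW : inverts W L,
    forall D : category, cat_equivalence (cat_precomp LW D).

Program Definition ord_cat (n : nat) : category :=
  @Category 'I_n.+1 (fun i j => is_true (i <= j)) (fun i => leqnn i)
    (fun i j k v u => leq_trans u v) _ _ _.

Section Collage.
Variables (C D : category) (f : functor C D).

Definition collage_hom (x y : C + D) : Type :=
  match x, y with
  | inl c, inl c' => hom c c'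
  | inl c, inr d => hom (f c) d
  | inr _, inl _ => False
  | inr d, inr d' => hom d d'
  end.

Definition collage_id (x : C + D) : collage_hom x x :=
  match x with inl c => idm c | inr d => idm d end.

Definition collage_cmp (x y z : C + D) :
    collage_hom y z -> collage_hom x y -> collage_hom x z :=
  match x, y, z return collage_hom y z -> collage_hom x y -> collage_hom x z with
  | inl _, inl _, inl _ => fun v u => cmp v u
  | inl _, inl _, inr _ => fun v u => cmp v (fmap f u)
  | inl _, inr _, inr _ => fun v u => cmp v u
  | inr _, inr _, inr _ => fun v u => cmp v u
  | _, inr _, inl _ => fun v _ => match v with end
  | inr _, inl _, _ => fun _ u => match u with end
  end.

(** The pushout of [C * [1]] and [D] along the inclusion of [C] at the vertex 1
    and [f] (see [collage_rec] and [collage_rec_restrict]): an arrow from [c]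
    over 0 to [d] over 1 is an arrow from [f c] to [d]. *)
Program Definition collage : category :=
  @Category (C + D)%type collage_hom collage_id collage_cmp _ _ _.
Next Obligation. by case: x u => [x|x]; case: y => [y|y] //= u; rewrite cmp1m. Qed.
Next Obligation.
by case: x u => [x|x]; case: y => [y|y] //= u; rewrite ?fmap1 cmpm1.
Qed.
Next Obligation.
case: x u => [x|x]; case: y v => [y|y]; case: z w => [z|z]; case: t => [t|t] //=
  *; by rewrite ?fmapM cmpA.
Qed.

Definition collage_side (x : collage) : ord_cat 1 :=
  match x with inl _ => ord0 | inr _ => ord_max end.

Lemma collage_side_le (x y : collage) : hom x y -> collage_side x <= collage_side y.
Proof. by case: x y => [x|x] [y|y]. Qed.

Program Definition collage_proj : functor collage (ord_cat 1) :=
  @Functor collage (ord_cat 1) collage_side collage_side_le _ _.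

Definition collage_inl : functor C collage :=
  @Functor C collage (fun c => inl c) (fun _ _ u => u)
    (fun _ => erefl) (fun _ _ _ _ _ => erefl).

Definition collage_inr : functor D collage :=
  @Functor D collage (fun d => inr d) (fun _ _ u => u)
    (fun _ => erefl) (fun _ _ _ _ _ => erefl).

Program Definition collage_trans :
    nattrans collage_inl (fcomp collage_inr f) :=
  @NatTrans _ _ collage_inl (fcomp collage_inr f)
    (fun c => idm (f c) : hom (collage_inl c) (collage_inr (f c))) _.
Next Obligation. by rewrite cmp1m cmpm1. Qed.

Section Pushout.
Variables (T : category) (H : functor C T) (G : functor D T).
Variable tau : nattrans H (fcomp G f).

Definition collage_rec_ob (x : collage) : T :=
  match x with inl c => H c | inr d => G d end.

Definition collage_rec_hom (x y : collage) :
    hom x y -> hom (collage_rec_ob x) (collage_rec_ob y) :=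
  match x, y return collage_hom x y -> hom (collage_rec_ob x) (collage_rec_ob y) with
  | inl _, inl _ => fun u => fmap H u
  | inl c, inr _ => fun u => cmp (fmap G u) (tau c)
  | inr _, inl _ => fun u => match u with end
  | inr _, inr _ => fun u => fmap G u
  end.

Program Definition collage_rec : functor collage T :=
  @Functor collage T collage_rec_ob collage_rec_hom _ _.
Next Obligation. by case: x => [c|d]; apply: fmap1. Qed.
Next Obligation.
case: x u => [x|x]; case: y v => [y|y]; case: z => [z|z] //= v u.
- exact: fmapM.
- by rewrite fmapM -cmpA -(naturality tau) cmpA.
- by rewrite fmapM cmpA.
- exact: fmapM.
Qed.

Lemma collage_rec_inl : fcomp collage_rec collage_inl = H.
Proof. by apply: functor_ext => // *; exact: hcast_id. Qed.

Lemma collage_rec_inr : fcomp collage_rec collage_inr = G.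
Proof. by apply: functor_ext => // *; exact: hcast_id. Qed.

Lemma collage_rec_trans (c : C) :
  fmap collage_rec (collage_trans c) = tau c :> hom (H c) (G (f c)).
Proof. by rewrite /= fmap1 cmp1m. Qed.

End Pushout.

Program Definition collage_restrict (T : category) (K : functor collage T) :
    nattrans (fcomp K collage_inl) (fcomp (fcomp K collage_inr) f) :=
  @NatTrans _ _ (fcomp K collage_inl) (fcomp (fcomp K collage_inr) f)
    (fun c => fmap K (collage_trans c)) _.
Next Obligation. by have /(congr1 (fmap K)) := naturality collage_trans u; rewrite !(fmapM K). Qed.

(** Functors out of the collage amount to a functor on [C], a functor on [D]
    and a natural transformation, that is, to a functor on [C * [1]] and a
    functor on [D] agreeing on [C]. *)
Lemma collage_rec_restrict (T : category) (K : functor collage T) :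
  collage_rec (collage_restrict K) = K.
Proof.
apply: functor_ext => [[x|x]|[x|x] [y|y] u ex ey] //=; rewrite hcast_id //.
by rewrite -(fmapM K) /= cmpm1.
Qed.

Variables (WC : subcat C) (WD : subcat D).

Definition collage_in_W (x y : collage) : hom x y -> Prop :=
  match x, y return collage_hom x y -> Prop with
  | inl _, inl _ => fun u => WC _ _ u
  | inr _, inr _ => fun u => WD _ _ u
  | _, _ => fun _ => False
  end.

Program Definition collage_W : subcat collage := @Subcat collage collage_in_W _ _.
Next Obligation.
case: x u H0 => [x|x]; case: y v H => [y|y]; case: z => [z|z] //=;
  move=> *; exact: subcat_cmp.
Qed.
Next Obligation.
move: H => [v [vu uv]].
by case: x u v vu uv => [x|x]; case: y => [y|y] //= u v vu uv;
  apply: subcat_iso; exists v.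
Qed.

End Collage.

Definition cocartesian_arrow (E B : category) (p : functor E B) (x y : E)
    (u : hom x y) : Prop :=
  forall (z : E) (v : hom x z) (w : hom (p y) (p z)),
    cmp w (fmap p u) = fmap p v ->
    exists! v' : hom y z, fmap p v' = w /\ cmp v' u = v.

Definition cocartesian_fibration (E B : category) (p : functor E B) : Prop :=
  forall (x : E) (b : B) (w : hom (p x) b),
    exists (y : E) (e : p y = b) (u : hom x y),
      cocartesian_arrow p u /\ hcast erefl e (fmap p u) = w.

(** Since [1] is a poset, every arrow between objects over [i] lies over the
    identity of [i]. *)
Definition fiber (E : category) (p : functor E (ord_cat 1)) (i : ord_cat 1) :
    category :=
  full_subcat (fun x : E => p x = i).

(** [g : C' -> D'] classifies [p : E -> [1]], with respect to identifications
    [h0], [h1] of [C'], [D'] with the fibers: a functor from [C' * [1]] to [E]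
    over [1] extending [h0] and [h1 g] is the same as a natural transformation
    from [h0] to [h1 g]. *)
Definition classified_by (E C' D' : category) (p : functor E (ord_cat 1))
    (h0 : functor C' (fiber p ord0)) (h1 : functor D' (fiber p ord_max))
    (g : functor C' D') : Prop :=
  [/\ cat_equivalence h0, cat_equivalence h1 &
    exists s : nattrans (fcomp (full_incl _) h0)
                        (fcomp (full_incl _) (fcomp h1 g)),
      forall c : C', cocartesian_arrow p (s c)].

(** [E'] is the localization of the collage, and the identifications of its
    fibers with [C'] and [D'] are required to be compatible with the
    localization functors.  As the fibers are full subcategories of [E'], this
    compatibility may be expressed in [E']. *)
Definition left_derived_functor (C D : category) (f : functor C D)
    (WC : subcat C) (WD : subcat D) (C' D' : category)
    (LC : functor C C') (LD : functor D D') (f' : functor C' D') : Prop :=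
  [/\ localization WC LC, localization WD LD &
    exists (E' : category) (LE : functor (collage f) E')
      (p : functor E' (ord_cat 1)),
      [/\ localization (collage_W f WC WD) LE,
          fcomp p LE = collage_proj f,
          cocartesian_fibration p &
          exists (h0 : functor C' (fiber p ord0))
            (h1 : functor D' (fiber p ord_max)),
            [/\ inhabited (natiso (fcomp (full_incl _) (fcomp h0 LC))
                                  (fcomp LE (collage_inl f))),
                inhabited (natiso (fcomp (full_incl _) (fcomp h1 LD))
                                  (fcomp LE (collage_inr f))) &
                classified_by h0 h1 f']]].

#[projections(primitive)] Record mono (m n : nat) := Mono {
  mfun :> 'I_m.+1 -> 'I_n.+1;
  mono_le : forall i j : 'I_m.+1, i <= j -> mfun i <= mfun j }.

Lemma mono_ext m n (a b : mono m n) : (forall i, a i = b i) -> a = b.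
Proof.
case: a b => [a ha] [b hb] /= h.
have ab : a = b by apply: funext.
by case: _ / ab in hb h *; rewrite (Prop_irrelevance ha hb).
Qed.

Definition mono_id n : mono n n := @Mono n n id (fun _ _ h => h).

Definition mono_comp l m n (b : mono m n) (a : mono l m) : mono l n :=
  @Mono l n (fun i => b (a i)) (fun i j h => mono_le b (mono_le a h)).

Definition mono_const m n (i : 'I_n.+1) : mono m n :=
  @Mono m n (fun _ => i) (fun _ _ _ => leqnn i).

Lemma coface_subproof n (i : nat) (j : 'I_n.+1) : bump i j < n.+2.
Proof. by have := ltn_ord j; rewrite /bump; lia. Qed.

Lemma coface_le n i (j k : 'I_n.+1) :
  j <= k -> Ordinal (coface_subproof i j) <= Ordinal (coface_subproof i k).
Proof. by rewrite /= /bump; lia. Qed.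

(** The increasing map missing [i]; meaningful for [i <= n.+1] only. *)
Definition coface n (i : nat) : mono n n.+1 :=
  @Mono n n.+1 (fun j => Ordinal (coface_subproof i j)) (@coface_le n i).

Definition mono_first_edge n : mono 1 n.+1 :=
  @Mono 1 n.+1 (widen_ord (isT : 2 <= n.+2)) (fun _ _ h => h).

Record sset := SSet {
  simplices :> nat -> Type;
  act : forall m n, mono m n -> simplices n -> simplices m;
  act_id : forall n (x : simplices n), act (mono_id n) x = x;
  act_comp : forall l m n (b : mono m n) (a : mono l m) (x : simplices n),
    act (mono_comp b a) x = act a (act b x) }.

Arguments act {s m n} a x.

Record smap (X Y : sset) := SMap {
  smap_fun :> forall n, X n -> Y n;
  smap_act : forall m n (a : mono m n) (x : X n),
    smap_fun (act a x) = act a (smap_fun x) }.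

Arguments smap_fun {X Y} s n x.

Lemma smap_ext (X Y : sset) (F G : smap X Y) :
  (forall n (x : X n), F _ x = G _ x) -> F = G.
Proof.
case: F G => [F hF] [G hG] /= h.
have FG : F = G by do 2!(apply: functional_extensionality_dep => ?); apply: h.
by case: _ / FG in hG h *; rewrite (Prop_irrelevance hF hG).
Qed.

Definition smap_id (X : sset) : smap X X := @SMap X X (fun _ x => x) (fun _ _ _ _ => erefl).

Program Definition scomp (X Y Z : sset) (G : smap Y Z) (F : smap X Y) :
  smap X Z := @SMap X Z (fun n x => G _ (F _ x)) _.
Next Obligation. by rewrite !smap_act. Qed.

Program Definition simplex (n : nat) : sset :=
  @SSet (fun m => mono m n) (fun l m a b => mono_comp b a) _ _.

Program Definition sprod (X Y : sset) : sset :=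
  @SSet (fun n => X n * Y n)%type (fun m n a x => (act a x.1, act a x.2)) _ _.
Next Obligation. by rewrite !act_id. Qed.
Next Obligation. by rewrite !act_comp. Qed.

Program Definition sprod_mapl (X X' Y : sset) (F : smap X X') :
  smap (sprod X Y) (sprod X' Y) :=
  @SMap (sprod X Y) (sprod X' Y) (fun n x => (F _ x.1, x.2)) _.
Next Obligation. by rewrite smap_act. Qed.

Program Definition sprod_mapr (X Y Y' : sset) (F : smap Y Y') :
  smap (sprod X Y) (sprod X Y') :=
  @SMap (sprod X Y) (sprod X Y') (fun n x => (x.1, F _ x.2)) _.
Next Obligation. by rewrite smap_act. Qed.

Definition sproj2 (X Y : sset) : smap (sprod X Y) Y :=
  @SMap (sprod X Y) Y (fun n x => x.2) (fun _ _ _ _ => erefl).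

Definition simplex_map m n (a : mono m n) : smap (simplex m) (simplex n) :=
  @SMap (simplex m) (simplex n) (fun l b => mono_comp a b) (fun _ _ _ _ => erefl).

Program Definition sfun (X Y : sset) : sset :=
  @SSet (fun n => smap (sprod (simplex n) X) Y)
    (fun m n a F => scomp F (sprod_mapl X (simplex_map a))) _ _.
Next Obligation. by apply: smap_ext => m [b y]. Qed.
Next Obligation. by apply: smap_ext => k [c y]. Qed.

Program Definition ssub (X : sset) (P : forall n, X n -> Prop)
    (hP : forall m n (a : mono m n) (x : X n), P n x -> P m (act a x)) : sset :=
  @SSet (fun n => {x : X n | P n x})
    (fun m n a x => exist _ (act a (sval x)) (hP m n a (sval x) (svalP x))) _ _.
Next Obligation. by apply: eq_exist; rewrite act_id. Qed.
Next Obligation. by apply: eq_exist; rewrite act_comp. Qed.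

Definition ssub_incl (X : sset) (P : forall n, X n -> Prop) hP :
    smap (@ssub X P hP) X :=
  @SMap (@ssub X P hP) X (fun n x => sval x) (fun _ _ _ _ => erefl).

Definition face (X : sset) n (i : nat) (x : X n.+1) : X n := act (coface n i) x.

Definition degenerate_edge (X : sset) (x : X 0) : X 1 := act (mono_const 1 ord0) x.

Definition first_edge (X : sset) n (x : X n.+1) : X 1 := act (mono_first_edge n) x.

(** A horn with missing face [k], of dimension [n.+2], given by the faces
    opposite to the vertices [i <> k] (the value [x k] and the values beyond
    [n.+2] are irrelevant), subject to the simplicial identities. *)
Definition horn (X : sset) n (k : nat) (x : nat -> X n.+1) : Prop :=
  forall i j, i < j <= n.+2 -> i <> k -> j <> k ->
    face i (x j) = face j.-1 (x i).

Definition fills (X : sset) n (k : nat) (x : nat -> X n.+1) (y : X n.+2) : Prop :=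
  forall i, i <= n.+2 -> i <> k -> face i y = x i.

Definition is_quasicategory (X : sset) : Prop :=
  forall n k (x : nat -> X n.+1), 0 < k < n.+2 -> horn k x ->
    exists y, fills k x y.

Record quasicategory := QuasiCategory {
  qsset :> sset;
  quasicategoryP : is_quasicategory qsset }.

(** For an edge, [face 1] is the source and [face 0] the target; a 2-simplex
    exhibits its [face 1] as a composite of [face 2] followed by [face 0]. *)
Definition is_composite (X : sset) (e g h : X 1) : Prop :=
  exists s : X 2, [/\ face 2 s = e, face 0 s = g & face 1 s = h].

Definition is_equivalence_edge (X : sset) (e : X 1) : Prop :=
  exists g : X 1,
    is_composite e g (degenerate_edge (face 1 e)) /\
    is_composite g e (degenerate_edge (face 0 e)).

Definition functor_vertex (X Y : sset) (F : smap X Y) : sfun X Y 0 :=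
  scomp F (sproj2 (simplex 0) X).

Program Definition vertex_functor (X Y : sset) (F : sfun X Y 0) : smap X Y :=
  @SMap X Y (fun n x => F _ (mono_const n ord0, x)) _.
Next Obligation. by rewrite -smap_act. Qed.

Definition natural_equivalence (X Y : sset) (F G : smap X Y) : Prop :=
  exists e : sfun X Y 1,
    [/\ is_equivalence_edge e, face 1 e = functor_vertex F &
        face 0 e = functor_vertex G].

Definition qcat_equivalence (X Y : sset) (F : smap X Y) : Prop :=
  exists G : smap Y X,
    natural_equivalence (scomp G F) (smap_id X) /\
    natural_equivalence (scomp F G) (smap_id Y).

Lemma smap_is_equivalence_edge (X Y : sset) (F : smap X Y) (e : X 1) :
  is_equivalence_edge e -> is_equivalence_edge (F _ e).
Proof.
move=> [g [[s [s2 s0 s1]] [t [t2 t0 t1]]]]; exists (F _ g).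
split; [exists (F _ s) | exists (F _ t)];
  by rewrite /face /degenerate_edge -!smap_act; split; congr (F _ _).
Qed.

Definition in_core (X : sset) n (x : X n) : Prop :=
  forall a : mono 1 n, is_equivalence_edge (act a x).

Lemma in_core_act (X : sset) m n (a : mono m n) (x : X n) :
  in_core x -> in_core (act a x).
Proof. by move=> h b; rewrite -act_comp; apply: h. Qed.

(** The maximal Kan complex in the quasi-category of functors: the mapping
    space from [X] to [Y] in the infinity-category of infinity-categories. *)
Definition fun_space (X Y : sset) : sset := ssub (@in_core_act (sfun X Y)).

Definition edges (X : sset) := X 1 -> Prop.

Definition sinverts (X : sset) (W : edges X) (Y : sset) (F : smap X Y) : Prop :=
  forall e, W e -> is_equivalence_edge (F _ e).

Definition in_core_inverting (X : sset) (W : edges X) (Y : sset) n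
    (F : sfun X Y n) : Prop :=
  in_core F /\
  forall a : mono 0 n, sinverts W (vertex_functor (act a F : sfun X Y 0)).

Lemma in_core_inverting_act (X : sset) (W : edges X) (Y : sset) m n
    (a : mono m n) (F : sfun X Y n) :
  in_core_inverting W F -> in_core_inverting W (act a F : sfun X Y m).
Proof.
move=> [h k]; split; first exact: in_core_act.
by move=> b; rewrite -act_comp; apply: k.
Qed.

(** The union of the components of [fun_space X Y] formed by the functors that
    send [W] to equivalences. *)
Definition fun_space_inverting (X : sset) (W : edges X) (Y : sset) : sset :=
  ssub (@in_core_inverting_act X W Y).

Section Precomposition.
Variables (X X' : sset) (W : edges X) (L : smap X X').
Hypothesis LW : sinverts W L.

Program Definition sprecomp (Y : sset) : smap (sfun X' Y) (sfun X Y) :=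
  @SMap (sfun X' Y) (sfun X Y)
    (fun n F => scomp F (sprod_mapr (simplex n) L)) _.
Next Obligation. exact: smap_ext. Qed.

Lemma sprecomp_inverting (Y : sset) n (F : sfun X' Y n) :
  in_core F -> in_core_inverting W (sprecomp Y _ F).
Proof.
move=> h; split => a; first by rewrite -smap_act; apply: smap_is_equivalence_edge.
move=> e /LW /(smap_is_equivalence_edge (vertex_functor (act a F : sfun X' Y 0))).
by [].
Qed.

Program Definition fun_space_precomp (Y : sset) :
    smap (fun_space X' Y) (fun_space_inverting W Y) :=
  @SMap (fun_space X' Y) (fun_space_inverting W Y)
    (fun n F => exist _ (sprecomp Y _ (sval F)) (sprecomp_inverting (svalP F))) _.
Next Obligation. by apply: eq_exist; apply: smap_ext. Qed.

End Precomposition.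

(** [L] is initial among the functors that send [W] to equivalences: for every
    [Y], precomposition with [L] identifies the mapping space from [X'] to [Y]
    with the space of functors from [X] to [Y] inverting [W]. *)
Definition infty_localization (X : sset) (W : edges X) (X' : quasicategory)
    (L : smap X X') : Prop :=
  exists LW : sinverts W L,
    forall Y : quasicategory, qcat_equivalence (fun_space_precomp LW Y).

Lemma ord_hom_eq n (i j : ord_cat n) (u v : hom i j) : u = v.
Proof. exact: (Prop_irrelevance (u : is_true (i <= j)) v). Qed.

Definition ord_functor m n (a : mono m n) : functor (ord_cat m) (ord_cat n) :=
  @Functor (ord_cat m) (ord_cat n) a (fun _ _ h => mono_le a h)
    (fun _ => ord_hom_eq _ _) (fun _ _ _ _ _ => ord_hom_eq _ _).

Program Definition nerve (C : category) : sset :=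
  @SSet (fun n => functor (ord_cat n) C)
    (fun m n a F => fcomp F (ord_functor a)) _ _.
Next Obligation. by apply: functor_ext => // *; exact: hcast_id. Qed.
Next Obligation. by apply: functor_ext => // *; exact: hcast_id. Qed.

Program Definition nerve_map (C D : category) (F : functor C D) :
    smap (nerve C) (nerve D) :=
  @SMap (nerve C) (nerve D) (fun n x => fcomp F x) _.
Next Obligation. by apply: functor_ext => // *; exact: hcast_id. Qed.

Definition nerve_edges (C : category) (W : subcat C) : edges (nerve C) :=
  fun e => W _ _ (fmap e (leq0n 1 : hom (ord0 : ord_cat 1) ord_max)).

(** The standard simplex is the nerve of the poset [0 <= ... <= n]. *)
Program Definition nerve_to_simplex (C : category) n
    (p : functor C (ord_cat n)) : smap (nerve C) (simplex n) :=
  @SMap (nerve C) (simplex n)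
    (fun m x => @Mono m n (fcomp p x) (fun i j h => fmap (fcomp p x) h)) _.

Definition inner_fibration (X S : sset) (p : smap X S) : Prop :=
  forall n k (x : nat -> X n.+1) (b : S n.+2), 0 < k < n.+2 ->
    horn k x -> fills k (fun i => p _ (x i)) b ->
    exists2 y, fills k x y & p _ y = b.

(** Horns missing the face opposite to the vertex 0 can be filled over [S] as
    soon as their edge from vertex 0 to vertex 1 is [e]. *)
Definition cocartesian_edge (X S : sset) (p : smap X S) (e : X 1) : Prop :=
  forall n (x : nat -> X n.+1) (b : S n.+2),
    horn 0 x -> first_edge (x n.+2) = e ->
    fills 0 (fun i => p _ (x i)) b ->
    exists2 y, fills 0 x y & p _ y = b.

Definition infty_cocartesian_fibration (X S : sset) (p : smap X S) : Prop :=
  inner_fibration p /\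
  forall (x : X 0) (b : S 1), face 1 b = p _ x ->
    exists e : X 1, [/\ cocartesian_edge p e, face 1 e = x & p _ e = b].

Section Fiber.
Variables (X : sset) (d : nat) (p : smap X (simplex d)) (i : 'I_d.+1).

Definition in_fiber n (x : X n) : Prop := p _ x = mono_const n i.

Lemma in_fiber_act m n (a : mono m n) (x : X n) :
  in_fiber x -> in_fiber (act a x).
Proof. by rewrite /in_fiber smap_act => ->. Qed.

Definition infty_fiber : sset := ssub in_fiber_act.

End Fiber.

Definition infty_classified_by (E C' D' : sset) (p : smap E (simplex 1))
    (h0 : smap C' (infty_fiber p ord0)) (h1 : smap D' (infty_fiber p ord_max))
    (g : smap C' D') : Prop :=
  [/\ qcat_equivalence h0, qcat_equivalence h1 &
    exists s : smap (sprod C' (simplex 1)) E,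
      [/\ scomp p s = sproj2 C' (simplex 1),
          forall n (c : C' n), s _ (c, mono_const n ord0) = sval (h0 _ c),
          forall n (c : C' n), s _ (c, mono_const n ord_max) = sval (h1 _ (g _ c)) &
          forall c : C' 0, cocartesian_edge p (s _ (degenerate_edge c, mono_id 1))]].

(** The compatibility of [h0], [h1] with the localization functors is expressed
    in [E']: an equivalence of [simplex 1] is degenerate, so a natural
    equivalence in [E'] between functors to a fiber lies in that fiber. *)
Definition infty_left_derived_functor (C D : category) (f : functor C D)
    (WC : subcat C) (WD : subcat D) (C' D' : quasicategory)
    (LC : smap (nerve C) C') (LD : smap (nerve D) D') (f' : smap C' D') : Prop :=
  [/\ infty_localization (nerve_edges WC) LC,
      infty_localization (nerve_edges WD) LD &
    exists (E' : quasicategory) (LE : smap (nerve (collage f)) E')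
      (p : smap E' (simplex 1)),
      [/\ infty_localization (nerve_edges (collage_W f WC WD)) LE,
          scomp p LE = nerve_to_simplex (collage_proj f),
          infty_cocartesian_fibration p &
          exists (h0 : smap C' (infty_fiber p ord0))
            (h1 : smap D' (infty_fiber p ord_max)),
            [/\ natural_equivalence (scomp (ssub_incl _) (scomp h0 LC))
                                    (scomp LE (nerve_map (collage_inl f))),
                natural_equivalence (scomp (ssub_incl _) (scomp h1 LD))
                                    (scomp LE (nerve_map (collage_inr f))) &
                infty_classified_by h0 h1 f']]].

Definition connected (S : sset) : S 0 -> S 0 -> Prop :=
  clos_refl_sym_trans (S 0)
    (fun a b => exists e : S 1, face 1 e = a /\ face 0 e = b).

(** Connected components, as the equivalence classes of vertices. *)
Definition pi0 (S : sset) : Type :=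
  {A : S 0 -> Prop | exists a, A = connected a}.

Lemma pi0_ext (S : sset) (A B : pi0 S) : sval A = sval B -> A = B.
Proof. by case: A B => [A hA] [B hB] /= AB; apply: eq_exist. Qed.

Program Definition component_of (S : sset) (a : S 0) : pi0 S :=
  exist _ (connected a) _.
Next Obligation. by exists a. Qed.

Lemma connected_eq (S : sset) (a b : S 0) :
  connected a b -> connected a = connected b.
Proof.
move=> ab; apply: funext => c; apply: propext; split => h.
  by apply: rst_trans h; apply: rst_sym.
exact: rst_trans ab h.
Qed.

Lemma component_of_eq (S : sset) (a b : S 0) :
  connected a b -> component_of a = component_of b.
Proof. by move=> ab; apply: pi0_ext; apply: connected_eq. Qed.

Lemma component_of_eqP (S : sset) (a b : S 0) :
  component_of a = component_of b -> connected a b.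
Proof. by case=> ->; apply: rst_refl. Qed.

Lemma pi0_ind (S : sset) (P : pi0 S -> Prop) :
  (forall a, P (component_of a)) -> forall A, P A.
Proof.
move=> h [A [a eA]]; have <- : component_of a = exist _ A (ex_intro _ a eA) by apply: pi0_ext.
exact: h.
Qed.

Lemma connected_smap (S T : sset) (F : smap S T) (a b : S 0) :
  connected a b -> connected (F _ a) (F _ b).
Proof.
elim=> [x y [e [ex ey]]|x|x y _|x y z _ xy _ yz].
- by apply: rst_step; exists (F _ e); rewrite -ex -ey /face !smap_act.
- exact: rst_refl.
- exact: rst_sym.
- exact: rst_trans xy yz.
Qed.

Program Definition pi0_map (S T : sset) (F : smap S T) (A : pi0 S) : pi0 T :=
  exist _ (fun t => exists2 a, sval A a & connected (F _ a) t) _.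
Next Obligation.
elim/pi0_ind: A => a; exists (F _ a); apply: funext => t; apply: propext.
split => [[b /(connected_smap F) ab]|h]; first exact: rst_trans ab.
by exists a => //; apply: rst_refl.
Qed.

Lemma pi0_mapE (S T : sset) (F : smap S T) (a : S 0) :
  pi0_map F (component_of a) = component_of (F _ a).
Proof.
apply: pi0_ext; apply: funext => t; apply: propext.
split => [[b /(connected_smap F) ab]|h]; first exact: rst_trans ab.
by exists a => //; apply: rst_refl.
Qed.

Lemma ord1_mono_const (m : nat) (a : mono m 0) : a = mono_const m ord0.
Proof. by apply: mono_ext => i; rewrite [LHS]ord1 [RHS]ord1. Qed.

Lemma act_mono00 (X : sset) (a : mono 0 0) (v : X 0) : act a v = v.
Proof. by rewrite -[RHS]act_id [mono_id 0]ord1_mono_const [a]ord1_mono_const. Qed.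

Section MappingSpace.
Variables (X : sset) (x y : X 0).

Definition in_mapping_space n (F : sfun (simplex 1) X n) : Prop :=
  forall m (a : mono m n),
    F _ (a, mono_const m ord0) = act (mono_const m ord0) x /\
    F _ (a, mono_const m ord_max) = act (mono_const m ord0) y.

Lemma in_mapping_space_act m n (a : mono m n) (F : sfun (simplex 1) X n) :
  in_mapping_space F -> in_mapping_space (act a F : sfun (simplex 1) X m).
Proof. by move=> h l b; have := h l (mono_comp a b). Qed.

(** The function space from [x] to [y]: the fiber over [(x, y)] of
    [sfun (simplex 1) X], mapped to [X * X] by evaluation at 0 and 1. *)
Definition mapping_space : sset := ssub in_mapping_space_act.

Definition arrow (a : mapping_space 0) : X 1 :=
  (sval a : smap _ _) _ (mono_const 1 ord0, mono_id 1).

Lemma arrow_act (a : mapping_space 0) m (b : mono m 1) (c : mono m 0) :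
  (sval a : smap _ _) _ (c, b) = act b (arrow a).
Proof. by rewrite /arrow -smap_act [c]ord1_mono_const. Qed.

Lemma arrow_inj (a b : mapping_space 0) : arrow a = arrow b -> a = b.
Proof.
move=> ab; case: a b ab => [a ha] [b hb] ab; apply: eq_exist.
apply: smap_ext => m [c d].
have /= -> := arrow_act (exist _ a ha) d c.
by have /= -> := arrow_act (exist _ b hb) d c; rewrite ab.
Qed.

Lemma arrow_source (a : mapping_space 0) : face 1 (arrow a) = x.
Proof.
rewrite /face -(arrow_act a _ (mono_const 0 ord0)).
have -> : coface 0 1 = mono_const 0 ord0.
  by apply: mono_ext => i; apply: val_inj; rewrite [i]ord1.
case: (svalP a 0 (mono_const 0 ord0)) => -> _.
exact: act_mono00.
Qed.

Lemma arrow_target (a : mapping_space 0) : face 0 (arrow a) = y.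
Proof.
rewrite /face -(arrow_act a _ (mono_const 0 ord0)).
have -> : coface 0 0 = mono_const 0 ord_max.
  by apply: mono_ext => i; apply: val_inj; rewrite [i]ord1.
case: (svalP a 0 (mono_const 0 ord0)) => _ ->.
exact: act_mono00.
Qed.

Section OfEdge.
Variables (e : X 1) (ex : face 1 e = x) (ey : face 0 e = y).

Program Definition of_edge_fun : sfun (simplex 1) X 0 :=
  @SMap (sprod (simplex 0) (simplex 1)) X (fun m c => act c.2 e) _.
Next Obligation. by rewrite -act_comp. Qed.

Lemma of_edge_in : in_mapping_space of_edge_fun.
Proof.
move=> m a /=; rewrite -ex -ey /face -!act_comp.
by split; congr (act _ e); apply: mono_ext => i; apply: val_inj.
Qed.

Definition of_edge : mapping_space 0 := exist _ of_edge_fun of_edge_in.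

Lemma arrow_of_edge : arrow of_edge = e.
Proof. exact: act_id. Qed.

End OfEdge.

End MappingSpace.

Section Quasi.
Variable X : quasicategory.

Lemma degenerate_source (v : X 0) : face 1 (degenerate_edge v) = v.
Proof.
by rewrite /face /degenerate_edge -act_comp act_mono00.
Qed.

Lemma degenerate_target (v : X 0) : face 0 (degenerate_edge v) = v.
Proof.
by rewrite /face /degenerate_edge -act_comp act_mono00.
Qed.

Lemma coface_comp n i j : i < j <= n.+2 ->
  mono_comp (coface n.+1 j) (coface n i) = mono_comp (coface n.+1 i) (coface n j.-1).
Proof.
move=> ij; apply: mono_ext => k; apply: val_inj => /=; rewrite /bump.
by have := ltn_ord k; lia.
Qed.

Lemma face_face n i j (s : X n.+2) : i < j <= n.+2 ->
  face i (face j s) = face j.-1 (face i s).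
Proof. by move=> ij; rewrite /face -!act_comp coface_comp. Qed.

Lemma composite_ex (e g : X 1) : face 0 e = face 1 g ->
  exists h, is_composite e g h.
Proof.
move=> eg.
have [|i j|s hs] := @quasicategoryP X 0 1 (fun i => if i is 0 then g else e).
- by [].
- by case: i => [|[|i]]; case: j => [|[|[|j]]] //= ???; (congruence || lia).
by exists (face 1 s), s; split => //; rewrite hs.
Qed.

Lemma is_composite_ends (e g h : X 1) : is_composite e g h ->
  [/\ face 0 e = face 1 g, face 1 h = face 1 e & face 0 h = face 0 g].
Proof.
move=> [s [<- <- <-]]; split.
- by rewrite (@face_face 0 0 2).
- by rewrite (@face_face 0 1 2).
- by rewrite (@face_face 0 0 1).
Qed.

Definition tetra (a b c d : X 2) (i : nat) : X 2 :=
  match i with 0 => a | 1 => b | 2 => c | _ => d end.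

(** The edges are indexed by the vertices of a 3-simplex. *)
Lemma composite_assoc1 (e01 e02 e03 e12 e13 e23 : X 1) :
  is_composite e01 e12 e02 -> is_composite e12 e23 e13 ->
  is_composite e01 e13 e03 -> is_composite e02 e23 e03.
Proof.
move=> [s3 [a1 a2 a3]] [s0 [b1 b2 b3]] [s2 [c1 c2 c3]].
have [|i j|s hs] := @quasicategoryP X 1 1 (tetra s0 s0 s2 s3).
- by [].
- by case: i => [|[|[|i]]]; case: j => [|[|[|[|j]]]] //= ???; (congruence || lia).
exists (face 1 s); split.
- by rewrite -(@face_face 1 1 3) // hs //= a3.
- by rewrite (@face_face 1 0 1) // hs //= b2.
- by rewrite -(@face_face 1 1 2) // hs //= c3.
Qed.

Lemma composite_assoc2 (e01 e02 e03 e12 e13 e23 : X 1) :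
  is_composite e01 e12 e02 -> is_composite e12 e23 e13 ->
  is_composite e02 e23 e03 -> is_composite e01 e13 e03.
Proof.
move=> [s3 [a1 a2 a3]] [s0 [b1 b2 b3]] [s1 [c1 c2 c3]].
have [|i j|s hs] := @quasicategoryP X 1 2 (tetra s0 s1 s0 s3).
- by [].
- by case: i => [|[|[|i]]]; case: j => [|[|[|[|j]]]] //= ???; (congruence || lia).
exists (face 2 s); split.
- by rewrite -(@face_face 1 2 3) // hs //= a1.
- by rewrite (@face_face 1 0 2) // hs //= b3.
- by rewrite (@face_face 1 1 2) // hs //= c3.
Qed.

Lemma codeg0_subproof (i : 'I_3) : i.-1 < 2.
Proof. by have := ltn_ord i; lia. Qed.

Lemma codeg0_le (i j : 'I_3) : i <= j ->
  Ordinal (codeg0_subproof i) <= Ordinal (codeg0_subproof j).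
Proof. by rewrite /=; lia. Qed.

Definition codeg0 : mono 2 1 := Mono codeg0_le.

Lemma codeg1_subproof (i : 'I_3) : minn i 1 < 2.
Proof. by lia. Qed.

Lemma codeg1_le (i j : 'I_3) : i <= j ->
  Ordinal (codeg1_subproof i) <= Ordinal (codeg1_subproof j).
Proof. by rewrite /=; lia. Qed.

Definition codeg1 : mono 2 1 := Mono codeg1_le.

Ltac mono_cases :=
  apply: mono_ext => -[[|[|[|?]]] ?] //; apply: val_inj => //=;
  rewrite /bump /=; lia.

Lemma codeg0_face :
  [/\ mono_comp codeg0 (coface 1 2) = mono_const 1 ord0,
      mono_comp codeg0 (coface 1 0) = mono_id 1 &
      mono_comp codeg0 (coface 1 1) = mono_id 1].
Proof. by split; mono_cases. Qed.

Lemma codeg1_face :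
  [/\ mono_comp codeg1 (coface 1 2) = mono_id 1,
      mono_comp codeg1 (coface 1 0) = mono_const 1 ord_max &
      mono_comp codeg1 (coface 1 1) = mono_id 1].
Proof. by split; mono_cases. Qed.

Lemma degenerate_edge_source (e : X 1) :
  degenerate_edge (face 1 e) = act (mono_const 1 ord0) e.
Proof.
by rewrite /degenerate_edge /face -act_comp; congr (act _ e); mono_cases.
Qed.

Lemma degenerate_edge_target (e : X 1) :
  degenerate_edge (face 0 e) = act (mono_const 1 ord_max) e.
Proof.
by rewrite /degenerate_edge /face -act_comp; congr (act _ e); mono_cases.
Qed.

Lemma composite_unit_l (e : X 1) :
  is_composite (degenerate_edge (face 1 e)) e e.
Proof.
exists (act codeg0 e); rewrite degenerate_edge_source /face -!act_comp.
by case: codeg0_face => -> -> ->; rewrite act_id.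
Qed.

Lemma composite_unit_r (e : X 1) :
  is_composite e (degenerate_edge (face 0 e)) e.
Proof.
exists (act codeg1 e); rewrite degenerate_edge_target /face -!act_comp.
by case: codeg1_face => -> -> ->; rewrite act_id.
Qed.

Lemma composite_unit_lr (v : X 0) :
  is_composite (degenerate_edge v) (degenerate_edge v) (degenerate_edge v).
Proof. by have := composite_unit_r (degenerate_edge v); rewrite degenerate_target. Qed.

Definition homotopic (e e' : X 1) : Prop :=
  is_composite e (degenerate_edge (face 0 e)) e'.

Lemma homotopic_ends (e e' : X 1) : homotopic e e' ->
  face 1 e' = face 1 e /\ face 0 e' = face 0 e.
Proof. by case/is_composite_ends => _ -> ->; rewrite degenerate_target. Qed.

Lemma homotopic_sym (e e' : X 1) : homotopic e e' -> homotopic e' e.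
Proof.
move=> h; have [_ h0] := homotopic_ends h; rewrite /homotopic h0.
exact: (composite_assoc1 h (composite_unit_lr _) (composite_unit_r e)).
Qed.

Lemma homotopic_trans (e e' e'' : X 1) :
  homotopic e e' -> homotopic e' e'' -> homotopic e e''.
Proof.
move=> h; have [_ h0] := homotopic_ends h; rewrite /homotopic h0 => k.
exact: (composite_assoc2 h (composite_unit_lr _) k).
Qed.

Lemma homotopic_left (e e' : X 1) :
  is_composite (degenerate_edge (face 1 e)) e e' -> homotopic e e'.
Proof.
move=> h; exact: (composite_assoc1 (composite_unit_l e) (composite_unit_r e) h).
Qed.

Lemma homotopicW_left (e e' : X 1) :
  homotopic e e' -> is_composite (degenerate_edge (face 1 e)) e e'.
Proof.
move=> h; exact: (composite_assoc2 (composite_unit_l e) (composite_unit_r e) h).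
Qed.

Lemma composite_unique (e g h h' : X 1) :
  is_composite e g h -> is_composite e g h' -> homotopic h h'.
Proof.
move=> k k'; have [_ _ h0] := is_composite_ends k; rewrite /homotopic h0.
exact: (composite_assoc1 k (composite_unit_r g) k').
Qed.

Lemma composite_homotopic (e g h e' g' h' : X 1) :
  homotopic e e' -> homotopic g g' -> homotopic h h' ->
  is_composite e g h -> is_composite e' g' h'.
Proof.
move=> ee gg hh k; have [eg h1 h0] := is_composite_ends k.
have {}k : is_composite e' g h.
  rewrite /homotopic eg in ee.
  exact: (composite_assoc1 ee (composite_unit_l g) k).
have {eg h1 h0} [eg h1 h0] := is_composite_ends k.
have {}k : is_composite e' g' h.
  have hid := composite_unit_r h; rewrite h0 in hid.
  exact: (composite_assoc2 k gg hid).
have [_ _ h0'] := is_composite_ends k.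
rewrite /homotopic h0' in hh.
exact: (composite_assoc2 k (composite_unit_r g') hh).
Qed.

Section Connected.
Variables x y : X 0.

Lemma connected_homotopic (a b : mapping_space x y 0) :
  connected a b -> homotopic (arrow a) (arrow b).
Proof.
elim=> {a b} [a b [e [<- <-]]|a|a b _|a b c _ ab _ bc].
- have en (f : mono 1 1) : (sval e : smap _ _) _ (f, mono_const 1 ord0) = degenerate_edge x
      /\ (sval e : smap _ _) _ (f, mono_const 1 ord_max) = degenerate_edge y.
    exact: (svalP e 1 f).
  have h1 : homotopic (arrow (face 1 e)) ((sval e : smap _ _) _ (mono_id 1, mono_id 1)).
    rewrite /homotopic arrow_target; exists ((sval e : smap _ _) _ (codeg0, codeg1)).
    rewrite /face -!smap_act /=.
    case: codeg0_face => -> -> ->; case: codeg1_face => -> -> ->.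
    split => //; last by case: (en (mono_id 1)).
    by congr (smap_fun (sval e : smap _ _) _ (_, _)); mono_cases.
  apply: (homotopic_trans h1); apply: homotopic_sym; apply: homotopic_left.
  rewrite arrow_source; exists ((sval e : smap _ _) _ (codeg1, codeg0)).
  rewrite /face -!smap_act /=.
  case: codeg0_face => -> -> ->; case: codeg1_face => -> -> ->.
  split => //; first by case: (en (mono_id 1)).
  by congr (smap_fun (sval e : smap _ _) _ (_, _)); mono_cases.
- exact: composite_unit_r.
- exact: homotopic_sym.
- exact: homotopic_trans ab bc.
Qed.

Lemma homotopic_square_subproof m (a b : mono m 1) (i : 'I_m.+1) :
  (if b i == 0 :> nat then 0 else (a i).+1) < 3.
Proof. by have := ltn_ord (a i); case: ifP => _; lia. Qed.

Lemma homotopic_square_le m (a b : mono m 1) (i j : 'I_m.+1) : i <= j ->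
  Ordinal (homotopic_square_subproof a b i)
    <= Ordinal (homotopic_square_subproof a b j).
Proof.
by move=> ij; have := mono_le a ij; have := mono_le b ij => /=; do 2!case: ifP; lia.
Qed.

Definition square_map m (a b : mono m 1) : mono m 2 :=
  Mono (@homotopic_square_le m a b).

Program Definition square_fun (s : X 2) : sfun (simplex 1) X 1 :=
  @SMap (sprod (simplex 1) (simplex 1)) X (fun m c => act (square_map c.1 c.2) s) _.
Next Obligation. by rewrite -act_comp; congr (act _ s); apply: mono_ext => i; apply: val_inj. Qed.

Lemma homotopic_connected (a b : mapping_space x y 0) :
  homotopic (arrow a) (arrow b) -> connected a b.
Proof.
rewrite /homotopic arrow_target => -[s [s2 s0 s1]].
have hs : in_mapping_space x y (square_fun s).
  move=> m c /=; split.
    rewrite -(arrow_source a) -s2 /face -!act_comp; congr (act _ s).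
    by apply: mono_ext => i; apply: val_inj.
  transitivity (act c (face 0 s)); last first.
    by rewrite s0 /degenerate_edge -act_comp; congr (act _ y); apply: mono_ext.
  by rewrite /face -act_comp; congr (act _ s); apply: mono_ext => i; apply: val_inj.
apply: rst_step; exists (exist _ (square_fun s) hs : mapping_space x y 1).
split; apply: arrow_inj; rewrite -?s1 -?s2 /arrow /=; congr (act _ s);
  by apply: mono_ext => -[[|[|?]] ?] //; apply: val_inj.
Qed.

Lemma connectedP (a b : mapping_space x y 0) :
  connected a b <-> homotopic (arrow a) (arrow b).
Proof. by split; [apply: connected_homotopic|apply: homotopic_connected]. Qed.

End Connected.

Section Composition.
Variables x y z : X 0.

Lemma composite_of (a : mapping_space x y 0) (b : mapping_space y z 0) :
  exists c : mapping_space x z 0, is_composite (arrow a) (arrow b) (arrow c).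
Proof.
have [|h ch] := @composite_ex (arrow a) (arrow b).
  by rewrite arrow_source arrow_target.
have [_ h1 h0] := is_composite_ends ch.
rewrite arrow_source in h1; rewrite arrow_target in h0.
by exists (of_edge h1 h0); rewrite arrow_of_edge.
Qed.

Definition ho_cmp_class (B : pi0 (mapping_space y z)) (A : pi0 (mapping_space x y))
    (c : mapping_space x z 0) : Prop :=
  exists a b, [/\ sval A a, sval B b & is_composite (arrow a) (arrow b) (arrow c)].

Lemma ho_cmp_classE a b c : is_composite (arrow a) (arrow b) (arrow c) ->
  ho_cmp_class (component_of b) (component_of a) = connected c.
Proof.
move=> abc; apply: funext => d; apply: propext; split.
  move=> [a' [b' [/= /connectedP aa' /connectedP bb' abd]]]; apply/connectedP.
  apply: composite_unique abd.
  by apply: composite_homotopic abc => //; apply: composite_unit_r.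
move=> /connectedP cd; exists a, b; split; [exact: rst_refl|exact: rst_refl|].
by apply: composite_homotopic abc => //; apply: composite_unit_r.
Qed.

Program Definition ho_cmp (B : pi0 (mapping_space y z))
    (A : pi0 (mapping_space x y)) : pi0 (mapping_space x z) :=
  exist _ (ho_cmp_class B A) _.
Next Obligation.
elim/pi0_ind: A => a; elim/pi0_ind: B => b.
by have [c abc] := composite_of a b; exists c; apply: ho_cmp_classE.
Qed.

Lemma ho_cmpE a b c : is_composite (arrow a) (arrow b) (arrow c) ->
  ho_cmp (component_of b) (component_of a) = component_of c.
Proof. by move=> abc; apply: pi0_ext; apply: ho_cmp_classE. Qed.

End Composition.

Definition ho_id_arrow (x : X 0) : mapping_space x x 0 :=
  of_edge (degenerate_source x) (degenerate_target x).

Definition ho_id (x : X 0) : pi0 (mapping_space x x) :=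
  component_of (ho_id_arrow x).

Lemma ho_cmp1m (x y : X 0) (A : pi0 (mapping_space x y)) :
  ho_cmp (ho_id y) A = A.
Proof.
elim/pi0_ind: A => a; apply: ho_cmpE; rewrite arrow_of_edge.
by have := composite_unit_r (arrow a); rewrite arrow_target.
Qed.

Lemma ho_cmpm1 (x y : X 0) (A : pi0 (mapping_space x y)) :
  ho_cmp A (ho_id x) = A.
Proof.
elim/pi0_ind: A => a; apply: ho_cmpE; rewrite arrow_of_edge.
by have := composite_unit_l (arrow a); rewrite arrow_source.
Qed.

Lemma ho_cmpA (x y z t : X 0) (C : pi0 (mapping_space z t))
    (B : pi0 (mapping_space y z)) (A : pi0 (mapping_space x y)) :
  ho_cmp C (ho_cmp B A) = ho_cmp (ho_cmp C B) A.
Proof.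
elim/pi0_ind: A => a; elim/pi0_ind: B => b; elim/pi0_ind: C => c.
have [ab hab] := composite_of a b; have [bc hbc] := composite_of b c.
have [abc habc] := composite_of ab c.
rewrite (ho_cmpE hab) (ho_cmpE hbc) (ho_cmpE habc); apply: esym.
exact: ho_cmpE (composite_assoc2 hab hbc habc).
Qed.

(** The conventional truncation: the objects are the vertices, and the arrows
    the connected components of the function spaces. *)
Definition Ho : category :=
  @Category (X 0) (fun x y => pi0 (mapping_space x y)) ho_id
    ho_cmp ho_cmp1m ho_cmpm1 ho_cmpA.

End Quasi.

Section HoMap.
Variables (X Y : quasicategory) (F : smap X Y).

Program Definition mapping_space_map (x y : X 0) :
    smap (mapping_space x y) (mapping_space (F _ x) (F _ y)) :=
  @SMap (mapping_space x y) (mapping_space (F _ x) (F _ y))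
    (fun n a => exist _ (scomp F (sval a : smap _ _)) _) _.
Next Obligation.
by move=> m c /=; have [-> ->] := H m c; rewrite !smap_act.
Qed.
Next Obligation. by apply: eq_exist; apply: smap_ext. Qed.

Lemma smap_composite (e g h : X 1) :
  is_composite e g h -> is_composite (F _ e) (F _ g) (F _ h).
Proof.
by move=> [s [<- <- <-]]; exists (F _ s); rewrite /face !smap_act.
Qed.

Program Definition Ho_map : functor (Ho X) (Ho Y) :=
  @Functor (Ho X) (Ho Y) (fun x => F _ x)
    (fun x y => pi0_map (mapping_space_map x y)) _ _.
Next Obligation.
rewrite pi0_mapE; congr component_of; apply: arrow_inj.
by rewrite arrow_of_edge /arrow /= act_id /degenerate_edge smap_act.
Qed.
Next Obligation.
elim/pi0_ind: v => b; elim/pi0_ind: u => a.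
have [c abc] := composite_of a b.
rewrite (ho_cmpE abc) !pi0_mapE; apply: esym; apply: ho_cmpE.
exact: (smap_composite abc).
Qed.

End HoMap.

Section Chains.
Variable C : category.

Section Edge.
Variables (x y : C) (u : hom x y).

Definition edge_ob (i : nat) : C := if i is 0 then x else y.

Definition edge_hom (i j : nat) : i <= j -> hom (edge_ob i) (edge_ob j) :=
  match i, j return i <= j -> hom (edge_ob i) (edge_ob j) with
  | 0, 0 => fun _ => idm x
  | 0, _.+1 => fun _ => u
  | _.+1, 0 => fun h => False_rect _ (Bool.diff_false_true h)
  | _.+1, _.+1 => fun _ => idm y
  end.

Program Definition nerve_edge : nerve C 1 :=
  @Functor (ord_cat 1) C (fun i => edge_ob i)
    (fun i j h => @edge_hom i j h) _ _.
Next Obligation. by case: x0 => -[|i]. Qed.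
Next Obligation.
move: x0 y0 z v u0 => [[|i] ?] [[|j] ?] [[|k] ?] //= *;
  by rewrite ?cmp1m ?cmpm1.
Qed.

End Edge.

Section Triangle.
Variables (x y z : C) (v : hom y z) (u : hom x y).

Definition triangle_ob (i : nat) : C :=
  match i with 0 => x | 1 => y | _ => z end.

Definition triangle_hom (i j : nat) : i <= j -> hom (triangle_ob i) (triangle_ob j) :=
  match i, j return i <= j -> hom (triangle_ob i) (triangle_ob j) with
  | 0, 0 => fun _ => idm x
  | 0, 1 => fun _ => u
  | 0, _.+2 => fun _ => cmp v u
  | 1, 1 => fun _ => idm y
  | 1, _.+2 => fun _ => v
  | _.+2, _.+2 => fun _ => idm z
  | _.+1, 0 => fun h => False_rect _ (Bool.diff_false_true h)
  | _.+2, 1 => fun h => False_rect _ (Bool.diff_false_true h)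
  end.

Program Definition nerve_triangle : nerve C 2 :=
  @Functor (ord_cat 2) C (fun i => triangle_ob i)
    (fun i j h => @triangle_hom i j h) _ _.
Next Obligation. by case: x0 => -[|[|i]]. Qed.
Next Obligation.
move: x0 y0 z0 v0 u0 => [[|[|i]] ?] [[|[|j]] ?] [[|[|k]] ?] //= *;
  by rewrite ?cmp1m ?cmpm1.
Qed.

End Triangle.

Lemma nerve_composite (x y z : C) (v : hom y z) (u : hom x y) :
  is_composite (nerve_edge u) (nerve_edge v) (nerve_edge (cmp v u)).
Proof.
exists (nerve_triangle v u); split; apply: functor_ext.
- by move=> [[|[|i]] ?].
- by move=> [[|[|i]] ?] [[|[|j]] ?] //= *; rewrite hcast_id.
- by move=> [[|[|i]] ?].
- by move=> [[|[|i]] ?] [[|[|j]] ?] //= *; rewrite hcast_id.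
- by move=> [[|[|i]] ?].
- by move=> [[|[|i]] ?] [[|[|j]] ?] //= *; rewrite hcast_id.
Qed.

Definition nerve_vertex (x : C) : nerve C 0 := face 1 (nerve_edge (idm x)).

Lemma nerve_edge_source (x y : C) (u : hom x y) :
  face 1 (nerve_edge u) = nerve_vertex x.
Proof.
apply: functor_ext; first by move=> [[|i] ?].
by move=> [[|i] ?] [[|j] ?] //= *; rewrite hcast_id.
Qed.

Lemma nerve_edge_target (x y : C) (u : hom x y) :
  face 0 (nerve_edge u) = nerve_vertex y.
Proof.
apply: functor_ext; first by move=> [[|i] ?].
by move=> [[|i] ?] [[|j] ?] //= *; rewrite hcast_id.
Qed.

Lemma nerve_edge_id (x : C) :
  nerve_edge (idm x) = degenerate_edge (nerve_vertex x).
Proof.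
apply: functor_ext; first by move=> [[|i] ?].
by move=> [[|i] ?] [[|j] ?] //= *; rewrite hcast_id.
Qed.

Variables (X : quasicategory) (L : smap (nerve C) X).

Lemma ho_unit_source (x y : C) (u : hom x y) :
  face 1 (L _ (nerve_edge u)) = L _ (nerve_vertex x).
Proof. by rewrite /face -smap_act -(nerve_edge_source u). Qed.

Lemma ho_unit_target (x y : C) (u : hom x y) :
  face 0 (L _ (nerve_edge u)) = L _ (nerve_vertex y).
Proof. by rewrite /face -smap_act -(nerve_edge_target u). Qed.

Program Definition Ho_of_nerve : functor C (Ho X) :=
  @Functor C (Ho X) (fun x => L _ (nerve_vertex x))
    (fun x y u => component_of (of_edge (ho_unit_source u) (ho_unit_target u)))
    _ _.
Next Obligation.
congr component_of; apply: arrow_inj; rewrite !arrow_of_edge nerve_edge_id.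
by rewrite /degenerate_edge smap_act.
Qed.
Next Obligation.
apply: esym; apply: ho_cmpE; rewrite !arrow_of_edge.
have [s [s2 s0 s1]] := nerve_composite v u.
by exists (L _ s); rewrite /face -!smap_act -s2 -s0 -s1.
Qed.

End Chains.

(* Main.v *)
From mathcomp Require Import all_boot zify.
From mathcomp Require Import boolp.
Require Import Defs.

(** The nerve of a category [D] is a quasi-category, so it may serve as a test
    object for an infinity-localization [L : nerve C -> X].  A map
    [X -> nerve D] is the same as a functor [Ho X -> D], an edge between two
    such maps is the same as a natural transformation, and likewise with
    [nerve C] and [C] in place of [X] and [Ho X]; hence the universal property
    of [L] tested against [nerve D] is the one of [C -> Ho X] tested against
    [D].  A cocartesian edge becomes a cocartesian arrow of the homotopy
    category: filling 2-dimensional outer horns gives existence of the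
    factorization and filling 3-dimensional ones gives its uniqueness.  Since
    every simplex of [simplex 1] is determined by its vertices, taking the
    homotopy category commutes with taking fibers over [simplex 1], so [Ho]
    carries all the data defining [f'] to those defining [Ho f']. *)

Set Implicit Arguments.
Unset Strict Implicit.
Unset Printing Implicit Defensive.

(** * The nerve of a category *)

Lemma pair_le n (i j : 'I_n.+1) (ij : i <= j) (k l : 'I_2) : k <= l ->
  (if k == 0 :> nat then i else j) <= (if l == 0 :> nat then i else j).
Proof. by case: ifP; case: ifP => //; case: k l => -[|[]] // ? [[|[]] ?]. Qed.

Definition mono_pair n (i j : 'I_n.+1) (ij : i <= j) : mono 1 n :=
  @Mono 1 n (fun k : 'I_2 => if k == 0 :> nat then i else j) (pair_le ij).

Lemma mono_pair_eta n (a : mono 1 n) (h : a ord0 <= a ord_max) : a = mono_pair h.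
Proof.
by apply: mono_ext => -[[|[|//]] ?] /=; congr (a _); apply: val_inj.
Qed.

Lemma mono01 n (a : mono 1 n) : a ord0 <= a ord_max.
Proof. exact: mono_le. Qed.

Definition triple_fun n (i j k : 'I_n.+1) (a : 'I_3) : 'I_n.+1 :=
  match val a with 0 => i | 1 => j | _ => k end.

Lemma triple_le n (i j k : 'I_n.+1) (ij : i <= j) (jk : j <= k) (a b : 'I_3) :
  a <= b -> triple_fun i j k a <= triple_fun i j k b.
Proof. by case: a b => -[|[|?]] ? [[|[|?]] ?] //= _; exact: leq_trans jk. Qed.

Definition mono_triple n (i j k : 'I_n.+1) (ij : i <= j) (jk : j <= k) : mono 2 n :=
  Mono (triple_le ij jk).

Lemma mono_triple_face n (i j k : 'I_n.+1) (ij : i <= j) (jk : j <= k) :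
  [/\ mono_comp (mono_triple ij jk) (coface 1 2) = mono_pair ij,
      mono_comp (mono_triple ij jk) (coface 1 0) = mono_pair jk &
      mono_comp (mono_triple ij jk) (coface 1 1) = mono_pair (leq_trans ij jk)].
Proof. by split; apply: mono_ext => -[[|[|?]] ?]. Qed.

Lemma act_triple (X : sset) n (i j k : 'I_n.+1) (ij : i <= j) (jk : j <= k) (s : X n) :
  is_composite (act (mono_pair ij) s) (act (mono_pair jk) s)
    (act (mono_pair (leq_trans ij jk)) s).
Proof.
exists (act (mono_triple ij jk) s); rewrite /face -!act_comp.
by case: (mono_triple_face ij jk) => -> -> ->.
Qed.

Lemma ord2_cases (P : 'I_2 -> Prop) : P ord0 -> P ord_max -> forall i, P i.
Proof.
move=> P0 P1 [[|[|//]] ?]; [move: P0|move: P1]; congr P; exact: val_inj.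
Qed.

Lemma act_composite (X : sset) n (a : mono 2 n) (s : X n) :
  is_composite (act (mono_comp a (coface 1 2)) s) (act (mono_comp a (coface 1 0)) s)
    (act (mono_comp a (coface 1 1)) s).
Proof. by exists (act a s); rewrite /face -!act_comp. Qed.

Lemma face_degenerate (X : sset) (v : X 0) i : face i (degenerate_edge v) = v.
Proof. by rewrite /face /degenerate_edge -act_comp act_mono00. Qed.

Lemma uncoface_subproof n l (i : 'I_n.+3) : (if l < i then i.-1 else minn i n.+1) < n.+2.
Proof. by have := ltn_ord i; case: ifP; lia. Qed.

Lemma uncoface_le n l (i j : 'I_n.+3) : i <= j ->
  Ordinal (uncoface_subproof l i) <= Ordinal (uncoface_subproof l j).
Proof. by have := ltn_ord j; rewrite /=; do 2!case: ifP; lia. Qed.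

(* A retraction of [coface n.+1 l]: it only matters away from the vertex [l]. *)
Definition uncoface n l : mono n.+2 n.+1 := Mono (@uncoface_le n l).

(** * Simplices of a nerve and their edges *)

Section NerveEdges.
Variable D : category.
Implicit Types (e g : nerve D 1).

Definition edge_mor e : hom (e ord0) (e ord_max) :=
  fmap e (leq0n 1 : hom (ord0 : ord_cat 1) ord_max).

Lemma fmap_eq (C : category) (F G : functor C D) (x y : C) (u : hom x y) :
  F = G -> exists ex ey, hcast ex ey (fmap F u) = fmap G u.
Proof. by move=> <-; exists erefl, erefl. Qed.

Lemma nerve_edge_inj (x y : D) : injective (@nerve_edge D x y).
Proof.
move=> u v /(@fmap_eq (ord_cat 1) _ _ ord0 ord_max isT).
by case=> ex [ey]; rewrite hcast_id.
Qed.

Lemma nerve_edge_eta e : nerve_edge (edge_mor e) = e.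
Proof.
apply: functor_ext; first by elim/ord2_cases.
elim/ord2_cases; elim/ord2_cases => u ex ey //.
- by rewrite (ord_hom_eq u (idm _)) !fmap1 hcast_id.
- by rewrite hcast_id; congr fmap; apply: ord_hom_eq.
- by rewrite (ord_hom_eq u (idm _)) !fmap1 hcast_id.
Qed.

Lemma nerve_vertex_eta (v : nerve D 0) : nerve_vertex (v ord0) = v.
Proof.
apply: functor_ext => [x|x y]; first by rewrite (ord1 x).
rewrite (ord1 x) (ord1 y) => u ex ey.
by rewrite (ord_hom_eq u (idm _)) !fmap1 hcast_id.
Qed.

Lemma nerve_vertex_inj : injective (@nerve_vertex D).
Proof. by move=> x y /(congr1 (fun F : nerve D 0 => F ord0)). Qed.

Lemma edge_homP (x y : D) e :
  face 1 e = nerve_vertex x -> face 0 e = nerve_vertex y ->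
  exists u : hom x y, nerve_edge u = e.
Proof.
rewrite -(nerve_edge_eta e) nerve_edge_source nerve_edge_target.
move=> /nerve_vertex_inj ex /nerve_vertex_inj ey.
by case: _ / ex; case: _ / ey; exists (edge_mor e).
Qed.

(** The arrow is chosen rather than transported from [edge_mor] along equalities of objects, so that
    no cast appears; later arguments use it only through [edge_homK]. *)
Definition edge_hom (x y : D) e (ex : face 1 e = nerve_vertex x)
  (ey : face 0 e = nerve_vertex y) : hom x y := sval (cid (edge_homP ex ey)).

Lemma edge_homK (x y : D) e (ex : face 1 e = nerve_vertex x)
  (ey : face 0 e = nerve_vertex y) : nerve_edge (edge_hom ex ey) = e.
Proof. exact: svalP (cid (edge_homP ex ey)). Qed.

Lemma act_pair_nerve n (i j : 'I_n.+1) (ij : i <= j) (s : nerve D n) :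
  act (mono_pair ij) s = nerve_edge (fmap s (ij : hom (i : ord_cat n) j)).
Proof.
rewrite -[LHS]nerve_edge_eta; congr nerve_edge.
by rewrite /edge_mor /=; congr fmap; apply: ord_hom_eq.
Qed.

Lemma nerve_edge_hcast (x x' y y' : D) (u : hom x y) (v : hom x' y') ex ey :
  nerve_edge u = nerve_edge v -> hcast ex ey u = v.
Proof.
by case: _ / ex in v *; case: _ / ey in v * => /nerve_edge_inj ->.
Qed.

(** Constant maps recover the objects and pairs recover the arrows. Comparing edges instead of
    arrows keeps casts between equal objects out of later arguments. *)
Lemma nerve_ext n (s t : nerve D n) :
  (forall a : mono 1 n, act a s = act a t) -> s = t.
Proof.
move=> st; apply: functor_ext => [i|i j ij ex ey].
  have := congr1 (fun F : nerve D 1 => F ord0) (st (mono_const 1 i)); exact.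
apply: nerve_edge_hcast; have := st (mono_pair ij).
by rewrite !act_pair_nerve.
Qed.

Lemma nerve_edge_cmp_eq (x y z x' y' z' : D) (u : hom x y) (v : hom y z)
    (u' : hom x' y') (v' : hom y' z') :
  nerve_edge u = nerve_edge u' -> nerve_edge v = nerve_edge v' ->
  nerve_edge (cmp v u) = nerve_edge (cmp v' u').
Proof.
move=> uu' vv'.
have ex : x = x'.
  by apply: nerve_vertex_inj; rewrite -(nerve_edge_source u) uu' nerve_edge_source.
have ey : y = y'.
  by apply: nerve_vertex_inj; rewrite -(nerve_edge_target u) uu' nerve_edge_target.
have ez : z = z'.
  by apply: nerve_vertex_inj; rewrite -(nerve_edge_target v) vv' nerve_edge_target.
case: _ / ex in u' uu' *; case: _ / ey in u' uu' v' vv' *.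
case: _ / ez in v' vv' *.
by rewrite (nerve_edge_inj uu') (nerve_edge_inj vv').
Qed.

Definition ord3_0 : 'I_3 := @Ordinal 3 0 isT.
Definition ord3_1 : 'I_3 := @Ordinal 3 1 isT.
Definition ord3_2 : 'I_3 := @Ordinal 3 2 isT.

Lemma triangle_faces (X : sset) (s : X 2) :
  [/\ face 2 s = act (@mono_pair 2 ord3_0 ord3_1 isT) s,
      face 0 s = act (@mono_pair 2 ord3_1 ord3_2 isT) s &
      face 1 s = act (@mono_pair 2 ord3_0 ord3_2 isT) s].
Proof.
by split; rewrite /face; congr (act _ s); apply: mono_ext; elim/ord2_cases; apply: val_inj.
Qed.

(** A 2-simplex is a functor on [0 <= 1 <= 2], so functoriality forces its value on [0 <= 2]. *)
Lemma nerve_composite_fun (x y z : D) (u : hom x y) (v : hom y z) (h : nerve D 1) :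
  is_composite (nerve_edge u) (nerve_edge v) h -> h = nerve_edge (cmp v u).
Proof.
move=> [s []]; have [-> -> ->] := triangle_faces s; rewrite !act_pair_nerve.
move=> su sv <-; rewrite -(nerve_edge_cmp_eq su sv) -(fmapM s).
by congr nerve_edge; congr fmap; apply: ord_hom_eq.
Qed.

Lemma nerve_composite_unique e g (h h' : nerve D 1) :
  is_composite e g h -> is_composite e g h' -> h = h'.
Proof.
move=> c c'; have eg : face 0 e = face 1 g.
  case: c => s [<- <- _]; rewrite /face -!act_comp.
  by congr (act _ s); apply: mono_ext => k; apply: val_inj; rewrite (ord1 k).
move: c c' eg; rewrite -(nerve_edge_eta e) -(nerve_edge_eta g).
move: (e ord0) (e ord_max) (edge_mor e) (g ord0) (g ord_max) (edge_mor g).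
move=> x y u y' z v c c'; rewrite (nerve_edge_source v) (nerve_edge_target u).
move=> /nerve_vertex_inj ey; case: _ / ey in v c c' *.
by rewrite (nerve_composite_fun c) (nerve_composite_fun c').
Qed.

Lemma nerve_composite_edge (x y z : D) (u : hom x y) (v : hom y z) (w : hom x z) :
  is_composite (nerve_edge u) (nerve_edge v) (nerve_edge w) -> w = cmp v u.
Proof. by move/nerve_composite_fun/nerve_edge_inj. Qed.

(** * Spines of simplices in a nerve *)

(** Peeling off the first step and shifting [o] and [s] makes every branch type-check by
    computation, without casts between objects. *)
Fixpoint nat_hom (o : nat -> D) (s : forall i, hom (o i) (o i.+1)) (i j : nat) :
    i <= j -> hom (o i) (o j) :=
  match i, j return i <= j -> hom (o i) (o j) with
  | 0, 0 => fun _ => idm (o 0)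
  | 0, j.+1 => fun _ => cmp (@nat_hom (o \o S) (fun k => s k.+1) 0 j isT) (s 0)
  | i.+1, 0 => fun h => False_rect _ (Bool.diff_false_true h)
  | i.+1, j.+1 => fun h => @nat_hom (o \o S) (fun k => s k.+1) i j h
  end.

Lemma nat_hom_id o s i (h : i <= i) : @nat_hom o s i i h = idm (o i).
Proof. by elim: i o s h => //= i IH o s h; apply: (IH (o \o S)). Qed.

Lemma nat_hom_cmp o s i j k (ij : i <= j) (jk : j <= k) (ik : i <= k) :
  @nat_hom o s i k ik = cmp (nat_hom s jk) (nat_hom s ij).
Proof.
elim: k o s i j ij jk ik => [|k IH] o s [|i] [|j] // ij jk ik.
- by rewrite /= cmp1m.
- by rewrite [nat_hom s ij]/= cmpm1 (Prop_irrelevance ik jk).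
- by rewrite /= (IH _ _ 0 j isT jk isT) cmpA.
- exact: (IH (o \o S)).
Qed.

Lemma nat_hom_step o s i (h : i <= i.+1) : @nat_hom o s i i.+1 h = s i.
Proof.
elim: i o s h => /= [|i IH] o s h; first by rewrite cmp1m.
exact: (IH (o \o S) (fun k => s k.+1)).
Qed.

Program Definition nat_simplex n (o : nat -> D) (s : forall i, hom (o i) (o i.+1)) :
    nerve D n :=
  @Functor (ord_cat n) D (fun i => o i) (fun i j h => nat_hom s h) _ _.
Next Obligation. exact: nat_hom_id. Qed.
Next Obligation. exact: nat_hom_cmp. Qed.

Definition step_edge n i (h : i < n) : mono 1 n :=
  @mono_pair n (Ordinal (leqW h : i < n.+1)) (Ordinal (h : i.+1 < n.+1)) (leqnSn i).

(** The chain of edges is infinite, which spares bounds on the indices; a finite chain has to be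
    prolonged before the lemma applies. *)
Lemma spine_filler n (e : nat -> nerve D 1) :
  (forall i, face 0 (e i) = face 1 (e i.+1)) ->
  exists y : nerve D n, forall i (h : i < n), act (step_edge h) y = e i.
Proof.
move=> es; pose o i := e i ord0.
have so i : exists u : hom (o i) (o i.+1), nerve_edge u = e i.
  apply: edge_homP; rewrite ?es -(nerve_edge_eta (e _));
  exact: (nerve_edge_source (edge_mor (e _))).
pose s i := sval (cid (so i)).
exists (@nat_simplex n o s) => i h; rewrite act_pair_nerve.
by rewrite -(svalP (cid (so i))) -/(s i) -(nat_hom_step s (leqnSn i)).
Qed.

(** The dimension is positive because a 0-simplex has no steps. The steps determine the vertices and
    then, by induction on the target, every longer edge as the composite of a shorter edge with a
    step. *)
Lemma spine_uniq n (y z : nerve D n.+1) :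
  (forall i (h : i < n.+1), act (step_edge h) y = act (step_edge h) z) -> y = z.
Proof.
move=> yz.
have yz0 i (hi : i < n.+2) : act (mono_const 0 (Ordinal hi)) y
    = act (mono_const 0 (Ordinal hi)) z.
  (* Every vertex but the last is the source of a step; the last one is the target of a step. *)
  case: (ltnP i n.+1) => hin.
    have := congr1 (face 1) (yz _ hin); rewrite /face -!act_comp.
    suff -> : mono_comp (step_edge hin) (coface 0 1) = mono_const 0 (Ordinal hi) by [].
    by apply: mono_ext => k; apply: val_inj; rewrite (ord1 k).
  case: i hi hin => // i hi hin.
  have := congr1 (face 0) (yz _ (hi : i < n.+1)); rewrite /face -!act_comp.
  suff -> : mono_comp (step_edge (hi : i < n.+1)) (coface 0 0)
    = mono_const 0 (Ordinal hi) by [].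
  by apply: mono_ext => k; apply: val_inj; rewrite (ord1 k).
apply: nerve_ext => a; rewrite (mono_pair_eta (mono01 a)).
move: (a ord0) (a ord_max) (mono01 a) => [i hi] [j hj] ij.
elim: j hj ij => [|j IH] hj ij.
  have -> : @mono_pair n.+1 (Ordinal hi) (Ordinal hj) ij
      = mono_comp (mono_const 0 (Ordinal hi)) (mono_const 1 ord0).
    apply: mono_ext; elim/ord2_cases; apply: val_inj => //=.
    by case: i hi ij => //.
  by rewrite !act_comp yz0.
have /orP[/eqP ei|lij] : (i == j.+1) || (i <= j) by rewrite -ltnS -leq_eqVlt.
  subst i.
  have -> : @mono_pair n.+1 (Ordinal hi) (Ordinal hj) ij
      = mono_comp (mono_const 0 (Ordinal hi)) (mono_const 1 ord0).
    by apply: mono_ext; elim/ord2_cases; apply: val_inj.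
  by rewrite !act_comp yz0.
have hj' : j < n.+2 by apply: ltnW.
pose oi := Ordinal hi; pose oj := Ordinal hj'; pose ok := Ordinal hj.
have ij' : oi <= oj by [].
have jk' : oj <= ok by exact: leqnSn.
have cy := act_triple ij' jk' y; have cz := act_triple ij' jk' z.
have -> : @mono_pair n.+1 (Ordinal hi) (Ordinal hj) ij
    = mono_pair (leq_trans ij' jk') by apply: mono_ext.
apply: (nerve_composite_unique cy).
have jkE : mono_pair jk' = step_edge (hj : j < n.+1).
  by apply: mono_ext; elim/ord2_cases; apply: val_inj.
by move: cz; rewrite jkE -yz -(IH hj').
Qed.

(** * Filling the inner horns of a nerve *)

Section Horn.
Variables (n k : nat) (x : nat -> nerve D n.+1).
Hypotheses (k_inner : 0 < k < n.+2) (hx : horn k x).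

(** Thus [a] factors through the face opposite to [l], which the horn provides, and
    [mono_comp (uncoface n l) a] is the factorization. *)
Definition avoids p (a : mono p n.+2) (l : nat) :=
  [/\ l <> k, l <= n.+2 & forall i, a i <> l :> nat].

(** A simplex lying in two given faces lies in their intersection, where the horn condition
    identifies the two restrictions. *)
Lemma horn_compat p (a : mono p n.+2) l l' : avoids a l -> avoids a l' ->
  act (mono_comp (uncoface n l) a) (x l) = act (mono_comp (uncoface n l') a) (x l').
Proof.
wlog ll' : l l' / l < l'.
  move=> W h h'; case: (ltngtP l l') => [?|?|->] //; first exact: W.
  by apply: esym; apply: W.
move=> [lk hl al] [l'k hl' al'].
(* Renumbering after the deletion of [l] and [l']: each deleted vertex below [a i] lowers the index
   by one. *)
pose b (i : 'I_p.+1) : nat := a i - (l < a i) - (l' < a i).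
have hb i : b i < n.+1.
  by have := ltn_ord (a i); have := al i; have := al' i; rewrite /b; lia.
have lb (i j : 'I_p.+1) : i <= j -> Ordinal (hb i) <= Ordinal (hb j).
  move=> /(mono_le a) /=; rewrite /b.
  by have := al i; have := al' i; have := al j; have := al' j; lia.
have -> : mono_comp (uncoface n l) a = mono_comp (coface n l'.-1) (Mono lb).
  apply: mono_ext => i; apply: val_inj; rewrite /= /bump /b.
  by have := al i; have := al' i; have := ltn_ord (a i); case: ifP; lia.
have -> : mono_comp (uncoface n l') a = mono_comp (coface n l) (Mono lb).
  apply: mono_ext => i; apply: val_inj; rewrite /= /bump /b.
  by have := al i; have := al' i; have := ltn_ord (a i); case: ifP; lia.
have := hx (i := l) (j := l'); rewrite /face !act_comp => -> //.
by rewrite ll'.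
Qed.

(** At most four values are forbidden, so one of [0, ..., 4] is free. In dimensions 2 and 3 the
    bound [l <= n.+2] leaves fewer candidates, and the innerness of [k] comes in. *)
Lemma avoids_exists (i j : nat) : i < j <= n.+2 ->
  n != 0 \/ j = i.+1 ->
  (j = i.+1 \/ (j = i.+2 /\ i.+1 <> k)) ->
  exists l, [/\ l <> k, l <= n.+2, l <> i, l <> j & l <> i.+1].
Proof.
move=> ij hn hj.
pose good l := [&& l != k, l <= n.+2, l != i, l != j & l != i.+1].
suff : has good (iota 0 5).
  by move=> /hasP[l _ /and5P[/eqP ? ? /eqP ? /eqP ? /eqP ?]]; exists l.
by rewrite /= /good; move: k_inner ij hn hj; lia.
Qed.

(* The filler is the composite of the spine of the horn.  Its face [j.+1] has an
   edge [j -> j.+2], which is compared with the given one inside another face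
   [l] containing the vertices [j], [j.+1] and [j.+2]. *)
Lemma nerve_horn_filler : exists y : nerve D n.+2, fills k x y.
Proof.
have step_ex i : exists e : nerve D 1, forall h : i < n.+2,
    exists2 l, avoids (step_edge h) l & e = act (mono_comp (uncoface n l) (step_edge h)) (x l).
  have [h|ni] : i < n.+2 \/ n.+2 <= i by lia.
    (* A default edge: nothing is asked of indices beyond the spine. *)
    2: by exists (act (mono_const 1 ord0) (x 0)) => h; lia.
  have [l [lk ln li lj _]] : exists l, [/\ l <> k, l <= n.+2, l <> i, l <> i.+1 & l <> i.+1].
    by apply: avoids_exists; [lia|right|left].
  exists (act (mono_comp (uncoface n l) (step_edge h)) (x l)) => h'.
  exists l; last by rewrite (Prop_irrelevance h h').
  by split => //; elim/ord2_cases => /= ?; [apply: li|apply: lj].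
have [e he] := choice step_ex.
have stepE i (h : i < n.+2) l : avoids (step_edge h) l ->
    e i = act (mono_comp (uncoface n l) (step_edge h)) (x l).
  by move=> al; have [l' al' ->] := he i h; apply: horn_compat.
(* Past the last vertex the chain is prolonged by a degenerate edge, to meet the hypothesis of
   [spine_filler]. *)
pose e' i := if i < n.+2 then e i else degenerate_edge (face 0 (e n.+1)).
have [|y hy] := @spine_filler n.+2 e'.
  move=> i; rewrite /e'; case: ifP => hi; case: ifP => hi1; last by rewrite !face_degenerate.
  - have [l al ->] := he i hi; have [l' al' ->] := he i.+1 hi1.
    have hi2 : i.+1 < n.+3 by lia.
    pose v : mono 0 n.+2 := mono_const 0 (Ordinal hi2).
    rewrite /face -!act_comp.
    have -> : mono_comp (mono_comp (uncoface n l) (step_edge hi)) (coface 0 0)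
        = mono_comp (uncoface n l) v.
      by apply: mono_ext => j; apply: val_inj; rewrite (ord1 j).
    have -> : mono_comp (mono_comp (uncoface n l') (step_edge hi1)) (coface 0 1)
        = mono_comp (uncoface n l') v.
      by apply: mono_ext => j; apply: val_inj; rewrite (ord1 j).
    apply: horn_compat; split.
    + by case: al.
    + by case: al.
    + by move=> j; case: al => _ _ /(_ ord_max).
    + by case: al'.
    + by case: al'.
    + by move=> j; case: al' => _ _ /(_ ord0).
  - by rewrite face_degenerate; congr (face 0 (e _)); lia.
  - by lia.
exists y => i hi ik; apply: spine_uniq => j hj.
have hj2 : j < n.+2 by lia.
rewrite /face -act_comp.
(* A step of the face [i] is again a step of [y], unless it jumps over the vertex [i]. *)
have [ij|ij] := eqVneq i j.+1; last first.
  pose m := bump i j; have hm : m < n.+2 by rewrite /m /bump; lia.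
  have -> : mono_comp (coface n.+1 i) (step_edge hj) = step_edge hm.
    apply: mono_ext; elim/ord2_cases; apply: val_inj => //=; rewrite /m /bump; lia.
  have am : avoids (step_edge hm) i.
    by split => //; elim/ord2_cases; rewrite /= /m /bump; lia.
  rewrite hy /e' hm (stepE _ hm _ am); congr (act _ (x i)).
  by apply: mono_ext; elim/ord2_cases; apply: val_inj; rewrite /= /m /bump; case: ifP; lia.
subst i.
(* Here [n] is not zero: otherwise [j.+1 = 1 = k]. *)
have [l [lk ln lj0 lj2 lj1]] : exists l, [/\ l <> k, l <= n.+2, l <> j, l <> j.+2 & l <> j.+1].
  by apply: avoids_exists; [lia|left; move: k_inner; lia|right].
have hj1 : j.+1 < n.+2 by lia.
pose oj : 'I_n.+3 := inord j; pose oj1 : 'I_n.+3 := inord j.+1.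
pose oj2 : 'I_n.+3 := inord j.+2.
have ej : oj = j :> nat by rewrite inordK //; lia.
have ej1 : oj1 = j.+1 :> nat by rewrite inordK //; lia.
have ej2 : oj2 = j.+2 :> nat by rewrite inordK //; lia.
have h01 : oj <= oj1 by lia.
have h12 : oj1 <= oj2 by lia.
pose t := mono_triple h01 h12.
have t2 : mono_comp t (coface 1 2) = step_edge hj2.
  by apply: mono_ext; elim/ord2_cases; apply: val_inj.
have t0 : mono_comp t (coface 1 0) = step_edge hj1.
  by apply: mono_ext; elim/ord2_cases; apply: val_inj.
have t1 : mono_comp t (coface 1 1) = mono_comp (coface n.+1 j.+1) (step_edge hj).
  by apply: mono_ext; elim/ord2_cases; apply: val_inj; rewrite /= ?ej ?ej2 /bump; lia.
have c := act_composite t y; rewrite t2 t0 t1 !hy /e' hj2 hj1 in c.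
have a2 : avoids (step_edge hj2) l.
  by split => //; elim/ord2_cases => /= ?; [apply: lj0|apply: lj1].
have a0 : avoids (step_edge hj1) l.
  by split => //; elim/ord2_cases => /= ?; [apply: lj1|apply: lj2].
have a1 : avoids (mono_comp t (coface 1 1)) l.
  by rewrite t1; split => //; elim/ord2_cases; rewrite /= /bump; lia.
(* The long edge also lies in the face [j.+1], where it is the step [j] of [x j.+1]. *)
have b1 : avoids (mono_comp t (coface 1 1)) j.+1.
  by rewrite t1; split => //; elim/ord2_cases; rewrite /= /bump; lia.
rewrite (stepE _ _ _ a2) (stepE _ _ _ a0) -t2 -t0 in c.
apply: (nerve_composite_unique c).
have := act_composite (mono_comp (uncoface n l) t) (x l).
rewrite -[mono_comp _ (coface 1 1)]/(mono_comp (uncoface n l) (mono_comp t (coface 1 1))).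
rewrite (horn_compat a1 b1) t1.
have -> : mono_comp (uncoface n j.+1) (mono_comp (coface n.+1 j.+1) (step_edge hj))
    = step_edge hj.
  by apply: mono_ext; elim/ord2_cases; apply: val_inj; rewrite /= /bump; case: ifP; lia.
by [].
Qed.

End Horn.

Lemma nerve_is_quasicategory : is_quasicategory (nerve D).
Proof. by move=> n k x k_inner hx; apply: nerve_horn_filler. Qed.

Definition qnerve : quasicategory := QuasiCategory nerve_is_quasicategory.

End NerveEdges.

(** * The homotopy category *)

Lemma is_composite_smap (X Y : sset) (F : smap X Y) (e g h : X 1) :
  is_composite e g h -> is_composite (F _ e) (F _ g) (F _ h).
Proof. by move=> [s [<- <- <-]]; exists (F _ s); rewrite /face !smap_act. Qed.

Section Classes.
Variable X : quasicategory.

(** The endpoints enter as equations, so that an edge represents an arrow between objects that are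
    only provably equal to its faces. *)
Definition cls (x y : Ho X) (e : X 1) (ex : face 1 e = x) (ey : face 0 e = y) :
  hom x y := component_of (of_edge ex ey).

Lemma cls_eqP (x y : Ho X) (e e' : X 1) (ex : face 1 e = x) (ey : face 0 e = y)
    (ex' : face 1 e' = x) (ey' : face 0 e' = y) :
  cls ex ey = cls ex' ey' <-> homotopic e e'.
Proof.
split => [/component_of_eqP/connectedP|h]; first by rewrite !arrow_of_edge.
by apply: component_of_eq; apply/connectedP; rewrite !arrow_of_edge.
Qed.

Lemma cls_eq (x y : Ho X) (e e' : X 1) (ex : face 1 e = x) (ey : face 0 e = y)
    (ex' : face 1 e' = x) (ey' : face 0 e' = y) :
  e = e' -> cls ex ey = cls ex' ey'.
Proof. by move=> ee; apply/cls_eqP; rewrite -ee; apply: composite_unit_r. Qed.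

Lemma cls_cmp (x y z : Ho X) (e g h : X 1) (ex : face 1 e = x) (ey : face 0 e = y)
    (gy : face 1 g = y) (gz : face 0 g = z) (hx : face 1 h = x) (hz : face 0 h = z) :
  is_composite e g h -> cmp (cls gy gz) (cls ex ey) = cls hx hz.
Proof. by move=> c; apply: ho_cmpE; rewrite !arrow_of_edge. Qed.

Lemma cls_id (x : Ho X) (e : X 1) (ex : face 1 e = x) (ey : face 0 e = x) :
  e = degenerate_edge (x : X 0) -> cls ex ey = idm x.
Proof. exact: cls_eq. Qed.

Lemma cls_surj (x y : Ho X) (A : hom x y) :
  exists e : X 1, exists (ex : face 1 e = x) (ey : face 0 e = y), cls ex ey = A.
Proof.
elim/pi0_ind: A => a; exists (arrow a), (arrow_source a), (arrow_target a).
by congr component_of; apply: arrow_inj; rewrite arrow_of_edge.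
Qed.

Definition rep (x y : Ho X) (A : hom x y) : X 1 := sval (cid (cls_surj A)).

Lemma rep_source (x y : Ho X) (A : hom x y) : face 1 (rep A) = x.
Proof. by rewrite /rep; case: cid => e [? []]. Qed.

Lemma rep_target (x y : Ho X) (A : hom x y) : face 0 (rep A) = y.
Proof. by rewrite /rep; case: cid => e [? []]. Qed.

Lemma repK (x y : Ho X) (A : hom x y) (ex : face 1 (rep A) = x)
    (ey : face 0 (rep A) = y) : cls ex ey = A.
Proof.
move: ex ey; rewrite /rep; case: cid => e /= [ex [ey <-]] *; exact: cls_eq.
Qed.

Lemma rep_cls (x y : Ho X) (e : X 1) (ex : face 1 e = x) (ey : face 0 e = y) :
  homotopic e (rep (cls ex ey)).
Proof.
apply/(cls_eqP ex ey (rep_source _) (rep_target _)); by rewrite repK.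
Qed.

(** Being a composite is invariant under homotopy of all three edges, so a 2-simplex exists even on
    the chosen representatives. *)
Lemma rep_cmp (x y z : Ho X) (A : hom x y) (B : hom y z) :
  is_composite (rep A) (rep B) (rep (cmp B A)).
Proof.
have [h c] : exists h, is_composite (rep A) (rep B) h.
  by apply: composite_ex; rewrite rep_source rep_target.
have [_ h1 h0] := is_composite_ends c.
rewrite rep_source in h1; rewrite rep_target in h0.
have := cls_cmp (rep_source A) (rep_target A) (rep_source B) (rep_target B) h1 h0 c.
rewrite !repK => ->.
apply: composite_homotopic c; first exact: composite_unit_r.
  exact: composite_unit_r.
exact: rep_cls.
Qed.

Lemma rep_id (x : Ho X) : homotopic (degenerate_edge (x : X 0)) (rep (idm x)).
Proof. exact: rep_cls. Qed.

Lemma is_iso_cls (x y : Ho X) (e : X 1) (ex : face 1 e = x) (ey : face 0 e = y) :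
  is_equivalence_edge e -> is_iso (cls ex ey).
Proof.
move=> [g [c c']]; have [eg _ _] := is_composite_ends c.
have [ge _ _] := is_composite_ends c'.
have gy : face 1 g = y by rewrite -eg.
have gx : face 0 g = x by rewrite ge.
exists (cls gy gx); subst x y; split.
  rewrite (cls_cmp (h := degenerate_edge (face 1 e))) ?face_degenerate //.
  by move=> ? ?; exact: cls_id.
rewrite (cls_cmp (h := degenerate_edge (face 0 e))) ?face_degenerate //.
by move=> ? ?; exact: cls_id.
Qed.

Lemma hcast_cls (x x' y y' : Ho X) (e e' : X 1) (ex : face 1 e = x) (ey : face 0 e = y)
  (ex' : face 1 e' = x') (ey' : face 0 e' = y') xx yy :
  e = e' -> hcast xx yy (cls ex ey) = cls ex' ey'.
Proof.
by case: _ / xx in ex' *; case: _ / yy in ey' * => ?; exact: cls_eq.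
Qed.

Lemma face1_pair n (i j : 'I_n.+1) (ij : i <= j) (s : X n) :
  face 1 (act (mono_pair ij) s) = act (mono_const 0 i) s.
Proof.
by rewrite /face -act_comp; congr (act _ s); apply: mono_ext => k; rewrite (ord1 k).
Qed.

Lemma face0_pair n (i j : 'I_n.+1) (ij : i <= j) (s : X n) :
  face 0 (act (mono_pair ij) s) = act (mono_const 0 j) s.
Proof.
by rewrite /face -act_comp; congr (act _ s); apply: mono_ext => k; rewrite (ord1 k).
Qed.

Program Definition unit_simplex n (s : X n) : nerve (Ho X) n :=
  @Functor (ord_cat n) (Ho X) (fun i => act (mono_const 0 i) s)
    (fun i j ij => cls (face1_pair ij s) (face0_pair ij s)) _ _.
Next Obligation.
apply: cls_id; rewrite /degenerate_edge -act_comp; congr (act _ s).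
by apply: mono_ext => k /=; case: ifP.
Qed.
Next Obligation.
apply/esym/cls_cmp; have := act_triple u v s.
by congr is_composite; congr (act _ s); apply: mono_ext.
Qed.

(** The unit of the adjunction between [Ho] and the nerve. *)
Program Definition ho_unit : smap X (nerve (Ho X)) := @SMap X (nerve (Ho X)) unit_simplex _.
Next Obligation.
apply: functor_ext => [i|i j ij ex ey] /=.
  by rewrite -act_comp; congr (act _ x); apply: mono_ext.
apply: hcast_cls; rewrite -act_comp; congr (act _ x).
by apply: mono_ext => k /=; case: ifP.
Qed.

Lemma nerve_edge_cls (x y x' y' : Ho X) (e e' : X 1) (ex : face 1 e = x)
    (ey : face 0 e = y) (ex' : face 1 e' = x') (ey' : face 0 e' = y') :
  e = e' -> nerve_edge (cls ex ey) = nerve_edge (cls ex' ey').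
Proof.
move=> ee; subst e' x y x' y'; congr nerve_edge; exact: cls_eq.
Qed.

Lemma ho_unit_edge (x y : Ho X) (e : X 1) (ex : face 1 e = x) (ey : face 0 e = y) :
  ho_unit _ e = nerve_edge (cls ex ey).
Proof.
rewrite -[LHS]nerve_edge_eta; apply: nerve_edge_cls.
by rewrite -[RHS]act_id; congr (act _ e); apply/esym/mono_pair_eta.
Qed.

Lemma ho_unit_rep (x y : Ho X) (A : hom x y) : ho_unit _ (rep A) = nerve_edge A.
Proof. by rewrite (ho_unit_edge (rep_source A) (rep_target A)) repK. Qed.

(** * Maps from a quasi-category to a nerve *)

Section Realize.
Variables (D : category) (T : smap X (nerve D)).

(** A homotopy is a 2-simplex, and composites in a nerve are unique. This is why a map to a nerve
    descends to [Ho X]. *)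
Lemma smap_homotopic (e e' : X 1) : homotopic e e' -> T _ e = T _ e'.
Proof.
move=> /(is_composite_smap T); have := composite_unit_r (T _ e : qnerve D 1).
have -> : T _ (degenerate_edge (face 0 e)) = degenerate_edge (face 0 (T _ e)).
  by rewrite /degenerate_edge /face !smap_act.
exact: nerve_composite_unique.
Qed.

Lemma realize_source (x y : Ho X) (A : hom x y) :
  face 1 (T _ (rep A)) = nerve_vertex (T _ (x : X 0) ord0).
Proof. by rewrite /face -smap_act -[act _ _]/(face 1 _) rep_source nerve_vertex_eta. Qed.

Lemma realize_target (x y : Ho X) (A : hom x y) :
  face 0 (T _ (rep A)) = nerve_vertex (T _ (y : X 0) ord0).
Proof. by rewrite /face -smap_act -[act _ _]/(face 0 _) rep_target nerve_vertex_eta. Qed.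

(** The adjunct of [T]. The choice made by [rep] is harmless, since homotopic edges have the same
    image. *)
Program Definition realize : functor (Ho X) D :=
  @Functor (Ho X) D (fun x => T _ (x : X 0) ord0)
    (fun x y A => edge_hom (realize_source A) (realize_target A)) _ _.
Next Obligation.
apply: nerve_edge_inj; rewrite edge_homK nerve_edge_id nerve_vertex_eta.
by rewrite -(smap_homotopic (rep_id x)) /degenerate_edge smap_act.
Qed.
Next Obligation.
apply: nerve_composite_edge; rewrite !edge_homK.
exact: (is_composite_smap T (rep_cmp u v)).
Qed.

Lemma realizeE (x y : Ho X) (A : hom x y) :
  T _ (rep A) = nerve_edge (fmap realize A).
Proof. by rewrite edge_homK. Qed.

End Realize.
End Classes.

(** * Edges of function complexes and naturality squares *)

Section EdgeTransformations.
Variables (S Y : sset).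

Program Definition eval_at (v : S 0) : smap (sfun S Y) Y :=
  @SMap (sfun S Y) Y (fun n F => (F : smap _ _) _ (mono_id n, act (mono_const n ord0) v)) _.
Next Obligation.
rewrite -smap_act /= -act_comp; congr (smap_fun x _ (_, act _ v)).
Qed.

Lemma face_functor_vertex1 (e : sfun S Y 1) (T : smap S Y) n (x : S n) :
  face 1 e = functor_vertex T -> (e : smap _ _) _ (mono_const n ord0, x) = T _ x.
Proof.
move=> /(congr1 (fun F : sfun S Y 0 => (F : smap _ _) _ (mono_const n ord0, x))) /= <-.
by congr (smap_fun e _ (_, x)); apply: mono_ext => i; apply: val_inj.
Qed.

Lemma face_functor_vertex0 (e : sfun S Y 1) (T : smap S Y) n (x : S n) :
  face 0 e = functor_vertex T -> (e : smap _ _) _ (mono_const n ord_max, x) = T _ x.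
Proof.
move=> /(congr1 (fun F : sfun S Y 0 => (F : smap _ _) _ (mono_const n ord0, x))) /= <-.
by congr (smap_fun e _ (_, x)); apply: mono_ext => i; apply: val_inj.
Qed.

(** The square spanned by [e] and [q] is cut along its diagonal [d] into two triangles, obtained
    from [codeg0] and [codeg1] in the two possible orders. *)
Lemma edge_square (e : sfun S Y 1) (T T' : smap S Y) (q : S 1) :
  face 1 e = functor_vertex T -> face 0 e = functor_vertex T' ->
  exists d, is_composite (T _ q) (eval_at (face 0 q) _ e) d /\
            is_composite (eval_at (face 1 q) _ e) (T' _ q) d.
Proof.
move=> eT eT'; exists ((e : smap _ _) _ (mono_id 1, q)).
have [a2 a0 a1] := codeg0_face; have [b2 b0 b1] := codeg1_face.
split.
  exists ((e : smap _ _) _ (codeg0, act codeg1 q)).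
  rewrite /face -!smap_act /= -!act_comp a2 a0 a1 b2 b0 b1 act_id.
  rewrite (face_functor_vertex1 _ eT); split=> //.
  congr (smap_fun e _ (_, act _ q)).
  by apply: mono_ext => i; apply: val_inj.
exists ((e : smap _ _) _ (codeg1, act codeg0 q)).
rewrite /face -!smap_act /= -!act_comp a2 a0 a1 b2 b0 b1 act_id.
rewrite (face_functor_vertex0 _ eT'); split=> //.
congr (smap_fun e _ (_, act _ q)).
by apply: mono_ext => i; apply: val_inj.
Qed.

End EdgeTransformations.

(** * Functors and transformations with values in a nerve *)

Lemma is_iso_nerve_edge (D : category) (x y : D) (u : hom x y) :
  is_equivalence_edge (nerve_edge u) <-> is_iso u.
Proof.
split=> [[g [c c']]|[v [vu uv]]].
  have [eg _ _] := @is_composite_ends (qnerve D) _ _ _ c.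
  have [ge _ _] := @is_composite_ends (qnerve D) _ _ _ c'.
  rewrite nerve_edge_source nerve_edge_target in eg ge *.
  have gK := edge_homK (esym eg) ge; exists (edge_hom (esym eg) ge).
  rewrite -gK in c c'.
  rewrite nerve_edge_source -nerve_edge_id in c.
  rewrite nerve_edge_target -nerve_edge_id in c'.
  by rewrite (nerve_composite_edge c) (nerve_composite_edge c').
exists (nerve_edge v); rewrite nerve_edge_source nerve_edge_target -!nerve_edge_id -vu -uv.
by split; apply: nerve_composite.
Qed.

Lemma fun_core_iso (A B : category) (F G : fun_core A B) (a : hom F G) : is_iso a.
Proof.
have inv (x : A) := natiso_iso a x.
pose b x := sval (cid (inv x)).
have bK x : cmp (b x) (a x) = idm (F x) /\ cmp (a x) (b x) = idm (G x) := svalP (cid (inv x)).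
have nb x y (u : hom x y) : cmp (b y) (fmap G u) = cmp (fmap F u) (b x).
  rewrite -[LHS]cmpm1 -(bK x).2 cmpA -(cmpA (b y)) -(naturality a) cmpA (bK y).1.
  by rewrite cmp1m.
have ib x : is_iso (b x) by exists (a x); case: (bK x).
exists (@NatIso _ _ G F (@NatTrans _ _ G F b nb) ib).
by split; apply: natiso_ext => x /=; case: (bK x).
Qed.

(* A simplicial set standing for the category [A]: both [nerve A] itself and a
   quasi-category with homotopy category [A] carry such data. *)
Record marking (A : category) (S : sset) := Marking {
  mk_unit : smap S (nerve A);
  mk_vertex : A -> S 0;
  mk_edge : forall a b : A, hom a b -> S 1;
  mk_source : forall (a b : A) (u : hom a b), face 1 (mk_edge u) = mk_vertex a;
  mk_target : forall (a b : A) (u : hom a b), face 0 (mk_edge u) = mk_vertex b;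
  mk_unitE : forall (a b : A) (u : hom a b), mk_unit _ (mk_edge u) = nerve_edge u }.

Definition nerve_marking (A : category) : marking A (nerve A) :=
  @Marking A (nerve A) (smap_id _) (@nerve_vertex A) (@nerve_edge A)
    (@nerve_edge_source A) (@nerve_edge_target A) (fun _ _ _ => erefl).

Definition ho_marking (X : quasicategory) : marking (Ho X) X :=
  @Marking (Ho X) X (ho_unit X) (fun x => x) (@rep X) (@rep_source X) (@rep_target X)
    (@ho_unit_rep X).

Section Models.
Variables (A : category) (S : sset) (M : marking A S).

Section Target.
Variable D : category.
Implicit Types (T : smap S (nerve D)) (K : functor A D).

(** A form of the adjunction between maps to [nerve D] and functors to [D], stated as a relation so
    that it covers [nerve A] and quasi-categories with homotopy category [A] alike. *)
Definition models T K := forall (a b : A) (u : hom a b),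
  T _ (mk_edge M u) = nerve_edge (fmap K u).

Lemma models_vertex T K (a : A) : models T K ->
  T _ (mk_vertex M a) = nerve_vertex (K a).
Proof.
by move=> TK; rewrite -(mk_source M (idm a)) /face smap_act TK; exact: nerve_edge_source.
Qed.

Lemma mk_unit_vertex (a : A) : mk_unit M _ (mk_vertex M a) = nerve_vertex a.
Proof.
by rewrite -(mk_source M (idm a)) /face smap_act mk_unitE; exact: nerve_edge_source.
Qed.

Lemma eval_source (e : sfun S (nerve D) 1) T v : face 1 e = functor_vertex T ->
  face 1 (eval_at (nerve D) v _ e) = T _ v.
Proof. by move=> eT; rewrite /face -smap_act -[act _ _]/(face 1 _) eT /= act_mono00. Qed.

Lemma eval_target (e : sfun S (nerve D) 1) T v : face 0 e = functor_vertex T ->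
  face 0 (eval_at (nerve D) v _ e) = T _ v.
Proof. by move=> eT; rewrite /face -smap_act -[act _ _]/(face 0 _) eT /= act_mono00. Qed.

(** The components are the values of [e] at the marked vertices; they are natural because both
    composites in [edge_square] equal the diagonal. *)
Lemma edge_nattransP (e : sfun S (nerve D) 1) T T' K K' :
  face 1 e = functor_vertex T -> face 0 e = functor_vertex T' ->
  models T K -> models T' K' ->
  exists n : nattrans K K',
    forall a, nerve_edge (n a) = eval_at (nerve D) (mk_vertex M a) _ e.
Proof.
move=> eT eT' TK TK'.
have e1 a : face 1 (eval_at (nerve D) (mk_vertex M a) _ e) = nerve_vertex (K a).
  by rewrite (eval_source _ eT) (models_vertex _ TK).
have e0 a : face 0 (eval_at (nerve D) (mk_vertex M a) _ e) = nerve_vertex (K' a).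
  by rewrite (eval_target _ eT') (models_vertex _ TK').
pose n a := edge_hom (e1 a) (e0 a).
have nK a : nerve_edge (n a) = _ := edge_homK (e1 a) (e0 a).
have nat a b (u : hom a b) : cmp (n b) (fmap K u) = cmp (fmap K' u) (n a).
  have [d []] := edge_square (mk_edge M u) eT eT'.
  rewrite mk_source mk_target -!nK TK TK' => /nerve_composite_fun ->.
  exact: nerve_composite_edge.
by exists (NatTrans nat).
Qed.

Lemma edge_natisoP (e : sfun S (nerve D) 1) T T' K K' :
  is_equivalence_edge e ->
  face 1 e = functor_vertex T -> face 0 e = functor_vertex T' ->
  models T K -> models T' K' ->
  exists n : natiso K K',
    forall a, nerve_edge (n a) = eval_at (nerve D) (mk_vertex M a) _ e.
Proof.
move=> ee eT eT' TK TK'; have [n nE] := edge_nattransP eT eT' TK TK'.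
have ni a : is_iso (n a).
  by apply/is_iso_nerve_edge; rewrite nE; apply: smap_is_equivalence_edge.
by exists (NatIso ni).
Qed.

Lemma natural_equivalence_natiso T T' K K' :
  natural_equivalence T T' -> models T K -> models T' K' -> inhabited (natiso K K').
Proof.
by move=> [e [ee eT eT']] TK TK'; have [n _] := edge_natisoP ee eT eT' TK TK'.
Qed.

End Target.

(* [h] presents, up to the marking, the functor [P] of [B] with values in a
   functor groupoid. *)
Definition models2 (B D : category) (h : smap (nerve B) (sfun S (nerve D)))
    (P : functor B (fun_core A D)) : Prop :=
  (forall b, models (vertex_functor (h _ (nerve_vertex b) : sfun S (nerve D) 0)) (P b)) /\
  (forall (b b' : B) (v : hom b b') a,
    eval_at (nerve D) (mk_vertex M a) _ (h _ (nerve_edge v))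
    = nerve_edge ((fmap P v : natiso _ _) a)).

Lemma vertex_functorK (Y : sset) (F : sfun S Y 0) : functor_vertex (vertex_functor F) = F.
Proof.
by apply: smap_ext => n [c x] /=; congr (smap_fun F _ (_, x)); apply/esym/ord1_mono_const.
Qed.

(** Evaluating [e] at an object [b] gives an edge of the function complex, hence an isomorphism
    [n b] by [edge_natisoP]. Evaluating the square of [e] along an arrow of [B] at each marked
    vertex gives naturality in [b]. *)
Lemma natural_equivalence_natiso2 (B D : category)
    (h h' : smap (nerve B) (sfun S (nerve D))) (P P' : functor B (fun_core A D)) :
  natural_equivalence h h' -> models2 h P -> models2 h' P' -> inhabited (natiso P P').
Proof.
move=> [e [ee eh eh']] [hP hP2] [hP' hP2'].
pose w b : sfun S (nerve D) 1 := eval_at (sfun S (nerve D)) (nerve_vertex b) _ e.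
have w_eq b : is_equivalence_edge (w b) by apply: smap_is_equivalence_edge.
have w1 b : face 1 (w b)
    = functor_vertex (vertex_functor (h _ (nerve_vertex b) : sfun S (nerve D) 0)).
  rewrite vertex_functorK /w /face -smap_act -[act _ _]/(face 1 e) eh /=.
  by congr (smap_fun h _ _); apply: act_mono00.
have w0 b : face 0 (w b)
    = functor_vertex (vertex_functor (h' _ (nerve_vertex b) : sfun S (nerve D) 0)).
  rewrite vertex_functorK /w /face -smap_act -[act _ _]/(face 0 e) eh' /=.
  by congr (smap_fun h' _ _); apply: act_mono00.
have ex b := edge_natisoP (w_eq b) (w1 b) (w0 b) (hP b) (hP' b).
pose n b : @hom (fun_core A D) (P b) (P' b) := sval (cid (ex b)).
have nE b a : nerve_edge ((n b : natiso _ _) a) = eval_at (nerve D) (mk_vertex M a) _ (w b).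
  by rewrite /n; case: (cid (ex b)).
have nat b b' (v : hom b b') :
    cmp (n b') (fmap P v) = cmp (fmap P' v) (n b).
  apply: natiso_ext => a /=.
  have [d []] := edge_square (nerve_edge v) eh eh'.
  rewrite nerve_edge_source nerve_edge_target.
  move=> /(is_composite_smap (eval_at (nerve D) (mk_vertex M a))).
  rewrite hP2 -nE => /nerve_composite_fun dE.
  move=> /(is_composite_smap (eval_at (nerve D) (mk_vertex M a))).
  rewrite hP2' -nE dE; exact: nerve_composite_edge.
by split; apply: (NatIso (natiso_trans := @NatTrans _ _ P P' n nat)) => b; apply: fun_core_iso.
Qed.

End Models.

(** * Localizations *)

Section Uncurry.
Variables A D : category.

Section Simplex.
Variables (n m : nat) (H : functor (ord_cat n) (fun_core A D)) (c : mono m n).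
Variable y : functor (ord_cat m) A.

Definition uncurry_ob (i : ord_cat m) : D := (H (c i) : functor A D) (y i).

(** The transformation part is taken first, at [y i], and the arrow of [A] second; by naturality the
    other order gives the same arrow. *)
Definition uncurry_hom (i j : ord_cat m) (h : hom i j) :
    hom (uncurry_ob i) (uncurry_ob j) :=
  cmp (fmap (H (c j) : functor A D) (fmap y h))
    ((fmap H (mono_le c h : @hom (ord_cat n) (c i) (c j)) : natiso _ _) (y i)).

Program Definition uncurry : nerve D m :=
  @Functor (ord_cat m) D uncurry_ob uncurry_hom _ _.
Next Obligation.
rewrite /uncurry_hom (fmap1 y) fmap1 cmp1m.
by rewrite (ord_hom_eq (mono_le _ _) (idm _)) (fmap1 H).
Qed.
Next Obligation.
rewrite /uncurry_hom (fmapM y) fmapM.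
rewrite (ord_hom_eq (mono_le _ _)
  (cmp (mono_le c v : @hom (ord_cat n) (c y0) (c z))
       (mono_le c u : @hom (ord_cat n) (c x) (c y0)))) (fmapM H) /=.
rewrite -!cmpA; congr cmp; rewrite !cmpA; congr cmp.
by rewrite naturality.
Qed.

End Simplex.

Variables (S : sset) (j : smap S (nerve A)).

Lemma uncurry_act n m l (H : functor (ord_cat n) (fun_core A D)) (c : mono m n)
    (b : mono l m) (y : nerve A m) :
  uncurry H (mono_comp c b) (act b y) = act b (uncurry H c y).
Proof.
by apply: functor_ext => // i k h ex ey; rewrite hcast_id.
Qed.

Lemma uncurry_actl n m k (H : nerve (fun_core A D) n) (c : mono m k)
    (b : mono k n) (y : nerve A m) :
  uncurry (act b H : nerve _ _) c y = uncurry H (mono_comp b c) y.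
Proof.
by apply: functor_ext => // i l h ex ey; rewrite hcast_id.
Qed.

Program Definition fun_simplex n (H : nerve (fun_core A D) n) : sfun S (nerve D) n :=
  @SMap (sprod (simplex n) S) (nerve D) (fun m cx => uncurry H cx.1 (j _ cx.2)) _.
Next Obligation. rewrite smap_act; exact: uncurry_act. Qed.

(** Taking for [j] the identity of [nerve C] or the unit of [X] gives the comparison maps on the two
    sides of precomposition with a localization. *)
Program Definition fun_nerve : smap (nerve (fun_core A D)) (sfun S (nerve D)) :=
  @SMap (nerve (fun_core A D)) (sfun S (nerve D)) fun_simplex _.
Next Obligation. by apply: smap_ext => l [c y]; apply: uncurry_actl. Qed.

Lemma nerve_groupoid_edge (e : nerve (fun_core A D) 1) : is_equivalence_edge e.
Proof. by rewrite -(nerve_edge_eta e); apply/is_iso_nerve_edge/fun_core_iso. Qed.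

Lemma fun_nerve_core n (H : nerve (fun_core A D) n) : in_core (fun_nerve _ H).
Proof.
move=> a; rewrite -smap_act; apply: smap_is_equivalence_edge; exact: nerve_groupoid_edge.
Qed.

Program Definition fun_nerve_space :
    smap (nerve (fun_core A D)) (fun_space S (nerve D)) :=
  @SMap (nerve (fun_core A D)) (fun_space S (nerve D))
    (fun n H => exist _ (fun_nerve _ H) (fun_nerve_core H)) _.
Next Obligation. by apply: eq_exist; exact: (smap_act fun_nerve a x). Qed.

End Uncurry.

Lemma uncurry_vertex (A D : category) (K : fun_core A D) m (c : mono m 0) (y : nerve A m) :
  uncurry (nerve_vertex K) c y = fcomp K y.
Proof.
rewrite [c]ord1_mono_const; apply: functor_ext => // i j h ex ey.
by rewrite hcast_id /= /uncurry_hom /= cmpm1.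
Qed.

Lemma nerve_map_edge (A D : category) (K : functor A D) (x y : A) (u : hom x y) :
  nerve_map K _ (nerve_edge u) = nerve_edge (fmap K u).
Proof.
rewrite -[LHS]nerve_edge_eta; congr nerve_edge.
Qed.

Lemma nerve_map_vertex (A D : category) (K : functor A D) (x : A) :
  nerve_map K _ (nerve_vertex x) = nerve_vertex (K x).
Proof. by rewrite -[LHS]nerve_vertex_eta. Qed.

Section FunNerveModels.
Variables (A D : category) (S : sset) (M : marking A S).

Lemma fun_nerve_models2 : models2 M (fun_nerve D (mk_unit M)) (fid _).
Proof.
split=> [K a b u|K K' v a] /=.
  by rewrite mk_unitE uncurry_vertex -nerve_map_edge.
rewrite smap_act mk_unit_vertex.
rewrite -[act _ _]/(degenerate_edge _) -nerve_edge_id.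
rewrite -[LHS]nerve_edge_eta; congr nerve_edge.
by rewrite /edge_mor /= /uncurry_hom /= fmap1 cmp1m.
Qed.

Lemma models2_comp (B B' : category) (h : smap (nerve B') (sfun S (nerve D)))
    (P : functor B' (fun_core A D)) (Q : functor B B') :
  models2 M h P -> models2 M (scomp h (nerve_map Q)) (fcomp P Q).
Proof.
move=> [hP hP2]; split=> [b|b b' v a].
  have := hP (Q b); rewrite -nerve_map_vertex; exact.
by rewrite -[RHS](hP2 _ _ (fmap Q v)) -nerve_map_edge.
Qed.

End FunNerveModels.

Lemma natural_equivalence_comp (X X' Y Y' : sset) (H : smap Y Y') (K : smap X' X)
    (F G : smap X Y) :
  natural_equivalence F G ->
  natural_equivalence (scomp H (scomp F K)) (scomp H (scomp G K)).
Proof.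
move=> [e [ee e1 e0]].
pose h (n : nat) (T : sfun X Y n) : sfun X' Y' n :=
  scomp H (scomp T (sprod_mapr (simplex n) K)).
have ha m n (a : mono m n) (T : sfun X Y n) : h _ (act a T) = act a (h _ T).
  exact: smap_ext.
pose hs : smap (sfun X Y) (sfun X' Y') := SMap ha.
exists (hs _ e); split; first exact: smap_is_equivalence_edge.
  by rewrite /face -smap_act -[act _ _]/(face 1 e) e1; apply: smap_ext.
by rewrite /face -smap_act -[act _ _]/(face 0 e) e0; apply: smap_ext.
Qed.

Section HoMarking.
Variable X : quasicategory.

(** The relation [models] tests chosen representatives only, but any edge is homotopic to one and
    [T] identifies homotopic edges. *)
Lemma models_cls (D : category) (T : smap X (nerve D)) (K : functor (Ho X) D)
    (x y : Ho X) (e : X 1) (ex : face 1 e = x) (ey : face 0 e = y) :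
  models (ho_marking X) T K -> T _ e = nerve_edge (fmap K (cls ex ey)).
Proof.
by move=> TK; rewrite -[RHS](TK x y); apply/smap_homotopic/rep_cls.
Qed.

Lemma realize_models (D : category) (T : smap X (nerve D)) :
  models (ho_marking X) T (realize T).
Proof. by move=> x y A; apply: realizeE. Qed.

(** A converse to [fun_nerve]: it will turn the homotopy inverse supplied by an
    infinity-localization into a functor between groupoids. *)
Lemma realize_functor (B D : category) (g : smap (nerve B) (sfun X (nerve D))) :
  (forall e : nerve B 1, is_equivalence_edge (g _ e)) ->
  exists P : functor B (fun_core (Ho X) D), models2 (ho_marking X) g P.
Proof.
move=> gcore.
pose T b := vertex_functor (g _ (nerve_vertex b) : sfun X (nerve D) 0).
pose P b : fun_core (Ho X) D := realize (T b).
have TP b : models (ho_marking X) (T b) (P b) by apply: realize_models.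
have g1 (b b' : B) (v : hom b b') : face 1 (g _ (nerve_edge v)) = functor_vertex (T b).
  by rewrite vertex_functorK /face -smap_act -[act _ _]/(face 1 _) nerve_edge_source.
have g0 (b b' : B) (v : hom b b') : face 0 (g _ (nerve_edge v)) = functor_vertex (T b').
  by rewrite vertex_functorK /face -smap_act -[act _ _]/(face 0 _) nerve_edge_target.
have ex (b b' : B) (v : hom b b') :=
  edge_natisoP (gcore (nerve_edge v)) (g1 _ _ v) (g0 _ _ v) (TP b) (TP b').
pose n b b' v : @hom (fun_core (Ho X) D) (P b) (P b') := sval (cid (ex b b' v)).
have nE b b' v x : eval_at (nerve D) (x : X 0) _ (g _ (nerve_edge v))
    = nerve_edge ((n b b' v : natiso _ _) x).
  by rewrite /n; case: (cid (ex b b' v)) => /= ? ->.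
have n1 b : n b b (idm b) = idm (P b).
  apply: natiso_ext => x; apply: nerve_edge_inj; rewrite -nE !nerve_edge_id.
  rewrite -(models_vertex x (TP b)) /degenerate_edge.
  rewrite (smap_act g) (smap_act (eval_at _ _)); congr act.
  rewrite /T /= (act_mono00 (mono_const 0 ord0)).
  by rewrite [mono_id 0]ord1_mono_const.
have nM b b' b'' (v : hom b' b'') (u : hom b b') :
    n _ _ (cmp v u) = cmp (n _ _ v) (n _ _ u).
  apply: natiso_ext => x; apply: nerve_composite_edge; rewrite -!nE.
  do 2!apply: is_composite_smap; exact: nerve_composite.
by exists (@Functor _ (fun_core (Ho X) D) P n n1 nM); split=> // *; apply: nE.
Qed.

End HoMarking.

Lemma full_natiso (A C : category) (P : C -> Prop) (F G : functor A (full_subcat P)) :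
  natiso (fcomp (full_incl P) F) (fcomp (full_incl P) G) -> inhabited (natiso F G).
Proof.
move=> [[a na] ia].
by split; exists (@NatTrans _ _ F G a na).
Qed.

(** * The universal property tested against nerves *)

Section Localization.
Variables (C : category) (W : subcat C) (X : quasicategory) (L : smap (nerve C) X).

Lemma ho_unit_of_nerve n (x : nerve C n) :
  ho_unit X _ (L _ x) = fcomp (Ho_of_nerve L) x.
Proof.
rewrite -[RHS]/(nerve_map (Ho_of_nerve L) _ x); apply: nerve_ext => a.
rewrite -!smap_act.
rewrite -(nerve_edge_eta (act a x)) nerve_map_edge; exact: ho_unit_edge.
Qed.

Hypothesis LW : sinverts (nerve_edges W) L.

Lemma Ho_of_nerve_inverts : inverts W (Ho_of_nerve L).
Proof.
move=> x y u uW; apply: is_iso_cls; apply: LW; rewrite /nerve_edges /=.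
exact: uW.
Qed.

Variable D : category.
Let B := full_subcat (C := fun_core C D) (@inverts C W D).
Let precomp : functor (fun_core (Ho X) D) B := cat_precomp Ho_of_nerve_inverts D.

Let fun_nerveC := scomp (fun_nerve D (smap_id (nerve C)))
  (nerve_map (full_incl (C := fun_core C D) (@inverts C W D))).

Lemma fun_nerveC_models2 : models2 (nerve_marking C) fun_nerveC (full_incl _).
Proof.
have [h h2] := models2_comp (full_incl (C := fun_core C D) (@inverts C W D))
  (fun_nerve_models2 D (nerve_marking C)).
by split.
Qed.

Lemma fun_nerveC_inverting n (H : nerve B n) :
  in_core_inverting (nerve_edges W) (fun_nerveC _ H).
Proof.
split; first exact: fun_nerve_core.
move=> a e; rewrite -smap_act -(nerve_edge_eta e) -(nerve_vertex_eta (act a H)).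
have [-> _] := fun_nerveC_models2 => eW; apply/is_iso_nerve_edge.
apply: (svalP (act a H ord0)); exact: eW.
Qed.

Program Definition fun_nerve_inverting :
    smap (nerve B) (fun_space_inverting (nerve_edges W) (nerve D)) :=
  @SMap (nerve B) (fun_space_inverting (nerve_edges W) (nerve D))
    (fun n H => exist _ (fun_nerveC _ H) (fun_nerveC_inverting H)) _.
Next Obligation. by apply: eq_exist; exact: (smap_act fun_nerveC a x). Qed.

(** The square formed by the two precompositions and the two comparison maps commutes strictly. *)
Lemma fun_nerve_precomp n (H : nerve (fun_core (Ho X) D) n) :
  fun_space_precomp LW (nerve D) _ (fun_nerve_space D (ho_unit X) _ H)
  = fun_nerve_inverting _ (nerve_map precomp _ H).
Proof.
apply: eq_exist; apply: smap_ext => m [c x].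
rewrite -[LHS]/(uncurry H c (ho_unit X _ (L _ x))) ho_unit_of_nerve.
by apply: functor_ext => // i j h ex ey; rewrite hcast_id.
Qed.

(** The homotopy inverse [G], restricted along [fun_nerve_inverting], is realized by a functor [P].
    The two natural equivalences, restricted along the comparison maps, become the isomorphisms that
    make [P] a quasi-inverse. *)
Lemma localization_test :
  qcat_equivalence (fun_space_precomp LW (qnerve D)) -> cat_equivalence precomp.
Proof.
move=> [G [GP PG]].
pose g : smap (nerve B) (sfun X (nerve D)) :=
  scomp (ssub_incl _) (scomp G fun_nerve_inverting).
have gcore (e : nerve B 1) : is_equivalence_edge (g _ e).
  by have := svalP (G _ (fun_nerve_inverting _ e)) (mono_id 1); rewrite act_id.
have [P gP] := realize_functor gcore.
exists P; split.
  have e := natural_equivalence_comp (ssub_incl _) (fun_nerve_space D (ho_unit X)) GP.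
  apply: (natural_equivalence_natiso2 e (M := ho_marking X)); last first.
    exact: (fun_nerve_models2 D (ho_marking X)).
  have -> : scomp (ssub_incl _) (scomp (scomp G (fun_space_precomp LW (qnerve D)))
      (fun_nerve_space D (ho_unit X))) = scomp g (nerve_map precomp).
    apply: smap_ext => n H.
    exact: (congr1 (fun v => sval (G n v)) (fun_nerve_precomp H)).
  exact: models2_comp.
suff [n] : inhabited (natiso
    (fcomp (full_incl (C := fun_core C D) (@inverts C W D)) (fcomp precomp P))
    (fcomp (full_incl (C := fun_core C D) (@inverts C W D)) (fid B))).
  exact: full_natiso n.
have e := natural_equivalence_comp (ssub_incl _) fun_nerve_inverting PG.
apply: (natural_equivalence_natiso2 e (M := nerve_marking C)); last first.
  exact: fun_nerveC_models2.
have [gP1 gP2] := gP; split=> [F a b u | F F' v a].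
  rewrite /= ; exact: (models_cls _ _ (gP1 F)).
rewrite -[RHS](gP2 _ _ v).
rewrite /= smap_act //.
Qed.

End Localization.

Lemma infty_localization_Ho (C : category) (W : subcat C) (X : quasicategory)
    (L : smap (nerve C) X) :
  infty_localization (nerve_edges W) L -> localization W (Ho_of_nerve L).
Proof.
by move=> [LW h]; exists (Ho_of_nerve_inverts LW) => D; apply/localization_test/h.
Qed.

(** * Equivalences and cocartesian fibrations *)

Lemma sval_inj (T : Type) (P : T -> Prop) : injective (@sval T P).
Proof. by move=> [a ha] [b hb] /= ab; apply: eq_exist. Qed.

Lemma Ho_map_cls (X Y : quasicategory) (F : smap X Y) (x y : Ho X) (e : X 1)
    (ex : face 1 e = x) (ey : face 0 e = y)
    (fx : face 1 (F _ e) = Ho_map F x) (fy : face 0 (F _ e) = Ho_map F y) :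
  fmap (Ho_map F) (cls ex ey) = cls fx fy.
Proof.
rewrite /= pi0_mapE; congr component_of; apply: arrow_inj.
by rewrite arrow_of_edge /arrow /= act_id.
Qed.

Lemma Ho_map_rep (X Y : quasicategory) (F : smap X Y) (x y : Ho X) (A : hom x y) :
  exists (fx : face 1 (F _ (rep A)) = Ho_map F x) (fy : face 0 (F _ (rep A)) = Ho_map F y),
    fmap (Ho_map F) A = cls fx fy.
Proof.
have fx : face 1 (F _ (rep A)) = Ho_map F x.
  by rewrite /face -smap_act -[act _ _]/(face 1 _) rep_source.
have fy : face 0 (F _ (rep A)) = Ho_map F y.
  by rewrite /face -smap_act -[act _ _]/(face 0 _) rep_target.
exists fx, fy; rewrite -(Ho_map_cls (rep_source A) (rep_target A)).
by rewrite repK.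
Qed.

Lemma Ho_map_models (X Y : quasicategory) (F : smap X Y) :
  models (ho_marking X) (scomp (ho_unit Y) F) (Ho_map F).
Proof.
by move=> x y A; have [fx [fy ->]] := Ho_map_rep F A; apply: ho_unit_edge.
Qed.

Lemma ho_unit_models (X : quasicategory) :
  models (ho_marking X) (ho_unit X) (fid (Ho X)).
Proof. by move=> x y A; apply: ho_unit_rep. Qed.

Section Compose.
Variables (A : category) (S : sset) (M : marking A S) (X : quasicategory).
Variables (T : smap S X) (K : functor A (Ho X)).
Hypothesis TK : models M (scomp (ho_unit X) T) K.

Lemma models_scomp (D : category) (U : smap X (nerve D)) (J : functor (Ho X) D) :
  models (ho_marking X) U J -> models M (scomp U T) (fcomp J K).
Proof.
move=> UJ a b u /=.
(* The unit is injective on vertices, so the endpoints are read off in [nerve (Ho X)]. *)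
have e1 : face 1 (T _ (mk_edge M u)) = K a.
  have := models_vertex a TK.
  rewrite -(mk_source M u) /face -smap_act => /(congr1 (fun F : nerve _ 0 => F ord0)) /= <-.
  by rewrite -smap_act act_mono00.
have e0 : face 0 (T _ (mk_edge M u)) = K b.
  have := models_vertex b TK.
  rewrite -(mk_target M u) /face -smap_act => /(congr1 (fun F : nerve _ 0 => F ord0)) /= <-.
  by rewrite -smap_act act_mono00.
rewrite (models_cls e1 e0 UJ); congr nerve_edge; congr fmap.
by apply: nerve_edge_inj; rewrite -ho_unit_edge -TK.
Qed.

End Compose.

Lemma Ho_of_nerve_models (C : category) (X : quasicategory) (L : smap (nerve C) X) :
  models (nerve_marking C) (scomp (ho_unit X) L) (Ho_of_nerve L).
Proof. by move=> a b u; apply: ho_unit_edge. Qed.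

Lemma natural_equivalence_scomp (X Y Z : sset) (H : smap Y Z) (F G : smap X Y) :
  natural_equivalence F G -> natural_equivalence (scomp H F) (scomp H G).
Proof.
move=> /(natural_equivalence_comp H (smap_id X)).
by congr natural_equivalence; apply: smap_ext.
Qed.

Lemma Ho_map_equivalence (X Y : quasicategory) (F : smap X Y) :
  qcat_equivalence F -> cat_equivalence (Ho_map F).
Proof.
move=> [G [GF FG]]; exists (Ho_map G); split.
  apply: (natural_equivalence_natiso (M := ho_marking X)
    (natural_equivalence_scomp (ho_unit X) GF)); last exact: ho_unit_models.
  exact: (models_scomp (Ho_map_models F) (Ho_map_models G)).
apply: (natural_equivalence_natiso (M := ho_marking Y)
  (natural_equivalence_scomp (ho_unit Y) FG)); last exact: ho_unit_models.
exact: (models_scomp (Ho_map_models G) (Ho_map_models F)).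
Qed.

(** * Equivalences of categories *)

Lemma whisker_right (A B C : category) (F F' : functor B C) (G : functor A B) :
  natiso F F' -> natiso (fcomp F G) (fcomp F' G).
Proof.
move=> a; have na x y (u : hom x y) :
  cmp (a (G y)) (fmap (fcomp F G) u) = cmp (fmap (fcomp F' G) u) (a (G x)).
  exact: (naturality a (fmap G u)).
exact: (@NatIso _ _ (fcomp F G) (fcomp F' G)
  (@NatTrans _ _ (fcomp F G) (fcomp F' G) (fun x => a (G x)) na)
  (fun x => natiso_iso a (G x))).
Qed.

Lemma whisker_left (A B C : category) (F F' : functor A B) (G : functor B C) :
  natiso F F' -> natiso (fcomp G F) (fcomp G F').
Proof.
move=> a; have na x y (u : hom x y) :
  cmp (fmap G (a y)) (fmap (fcomp G F) u) = cmp (fmap (fcomp G F') u) (fmap G (a x)).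
  by rewrite /= -!fmapM; congr fmap; exact: (naturality a u).
exact: (@NatIso _ _ (fcomp G F) (fcomp G F')
  (@NatTrans _ _ (fcomp G F) (fcomp G F') (fun x => fmap G (a x)) na)
  (fun x => is_iso_fmap G (natiso_iso a x))).
Qed.

Lemma fcompA (A B C D : category) (F : functor A B) (G : functor B C) (H : functor C D) :
  fcomp H (fcomp G F) = fcomp (fcomp H G) F.
Proof. by apply: functor_ext => // x y u ex ey; rewrite hcast_id. Qed.

Lemma fcomp1f (A B : category) (F : functor A B) : fcomp (fid B) F = F.
Proof. by apply: functor_ext => // x y u ex ey; rewrite hcast_id. Qed.

Lemma cat_equivalence_fcomp (A B C : category) (F : functor A B) (G : functor B C) :
  cat_equivalence F -> cat_equivalence G -> cat_equivalence (fcomp G F).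
Proof.
move=> [F' [[a] [b]]] [G' [[c] [d]]]; exists (fcomp F' G'); split; split.
  have := whisker_left F' (whisker_right F c); rewrite fcomp1f !fcompA => e.
  exact: natiso_cmp a e.
have := whisker_left G (whisker_right G' b); rewrite fcomp1f !fcompA => e.
exact: natiso_cmp d e.
Qed.

Lemma fully_faithful_equivalence (A B : category) (F : functor A B) :
  (forall y, exists x (u : hom (F x) y), is_iso u) ->
  (forall x y (v : hom (F x) (F y)), exists u : hom x y, fmap F u = v) ->
  (forall (x y : A) (u u' : hom x y), fmap F u = fmap F u' -> u = u') ->
  cat_equivalence F.
Proof.
move=> es full faith.
have [g gP] := choice es.
have [i iP] : exists i : forall y, hom (F (g y)) y, forall y, is_iso (i y).
  by exists (fun y => sval (cid (gP y))) => y; apply: svalP (cid (gP y)).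
have [k kP] : exists k : forall y, hom y (F (g y)),
    forall y, cmp (k y) (i y) = idm _ /\ cmp (i y) (k y) = idm _.
  by exists (fun y => sval (cid (iP y))) => y; apply: svalP (cid (iP y)).
have ki y := (kP y).1; have ik y := (kP y).2.
pose G1 y z (v : hom y z) : hom (g y) (g z) :=
  sval (cid (full _ _ (cmp (k z) (cmp v (i y))))).
have G1K y z (v : hom y z) : fmap F (G1 y z v) = cmp (k z) (cmp v (i y)).
  exact: svalP (cid (full _ _ (cmp (k z) (cmp v (i y))))).
have G11 y : G1 y y (idm y) = idm (g y) by apply: faith; rewrite G1K cmp1m ki fmap1.
have G1M x y z (v : hom y z) (u : hom x y) : G1 x z (cmp v u) = cmp (G1 y z v) (G1 x y u).
  apply: faith; rewrite fmapM !G1K -!cmpA; congr cmp; congr cmp.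
  by rewrite cmpA ik cmp1m.
pose G := @Functor B A g G1 G11 G1M.
have nB y z (v : hom y z) : cmp (i z) (fmap (fcomp F G) v) = cmp v (i y).
  by rewrite /= G1K cmpA ik cmp1m.
pose j x : hom (g (F x)) x := sval (cid (full _ _ (i (F x)))).
have jK x : fmap F (j x) = i (F x) := svalP (cid (full _ _ (i (F x)))).
have nA x y (u : hom x y) : cmp (j y) (fmap (fcomp G F) u) = cmp u (j x).
  by apply: faith; rewrite !fmapM !jK; apply: nB.
have ji x : is_iso (j x).
  have [j' j'K] := full _ _ (k (F x)); exists j'.
  by split; apply: faith; rewrite fmapM jK j'K fmap1.
exists G; split; split.
  exact: (@NatIso _ _ _ _ (@NatTrans _ _ (fcomp G F) (fid A) j nA) ji).
exact: (@NatIso _ _ _ _ (@NatTrans _ _ (fcomp F G) (fid B) i nB) iP).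
Qed.

(** * The homotopy category over the 1-simplex *)

Section Fibration.
Variables (X : quasicategory) (p : smap X (simplex 1)).

Lemma ho_proj_le (x y : Ho X) (A : hom x y) :
  p _ (x : X 0) ord0 <= p _ (y : X 0) ord0.
Proof.
move: (rep A) (rep_source A) (rep_target A) => e ex ey.
have := mono01 (p _ e); rewrite -ex -ey /face !smap_act /=.
set i := Ordinal _; set k := Ordinal _.
have -> : i = ord0 by apply: val_inj.
by have -> : k = ord_max by apply: val_inj.
Qed.

Definition ho_proj : functor (Ho X) (ord_cat 1) :=
  @Functor (Ho X) (ord_cat 1) (fun x => p _ (x : X 0) ord0) ho_proj_le
    (fun _ => ord_hom_eq _ _) (fun _ _ _ _ _ => ord_hom_eq _ _).

Lemma ho_proj_of_nerve (C : category) (L : smap (nerve C) X) (q : functor C (ord_cat 1)) :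
  scomp p L = nerve_to_simplex q -> fcomp ho_proj (Ho_of_nerve L) = q.
Proof.
move=> pL; apply: functor_ext => [x|x y u ex ey]; last exact: ord_hom_eq.
rewrite /= -[p _ _]/(scomp p L _ (nerve_vertex x)) pL //.
Qed.

Lemma proj_vertex n (s : X n) (k : 'I_n.+1) :
  p _ s k = p _ (act (mono_const 0 k) s) ord0.
Proof. by rewrite smap_act. Qed.

Lemma proj_edge (x y : X 0) (e : X 1) (xy : p _ x ord0 <= p _ y ord0) :
  face 1 e = x -> face 0 e = y -> p _ e = mono_pair xy.
Proof.
move=> ex ey; apply: mono_ext; elim/ord2_cases; rewrite proj_vertex /= -?ex -?ey;
  congr (p _ _ ord0); congr (act _ e);
  by apply: mono_ext => i; apply: val_inj; rewrite (ord1 i).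
Qed.

Lemma proj_triangle (x y z : X 0) (s : X 2) (xy : p _ x ord0 <= p _ y ord0)
    (yz : p _ y ord0 <= p _ z ord0) :
  face 1 (face 2 s) = x -> face 0 (face 2 s) = y -> face 0 (face 0 s) = z ->
  p _ s = mono_triple xy yz.
Proof.
move=> ex ey ez; apply: mono_ext => -[[|[|[|//]]] hk];
  rewrite proj_vertex /= /triple_fun /= -?ex -?ey -?ez;
  congr (p _ _ ord0); rewrite /face -!act_comp; congr (act _ s);
  by apply: mono_ext => i; apply: val_inj; rewrite (ord1 i).
Qed.

Section Cocartesian.
Variables (x y z : Ho X) (e : X 1) (ex : face 1 e = x) (ey : face 0 e = y).
Hypothesis pe : cocartesian_edge p e.
Variable w : hom (ho_proj y) (ho_proj z).

Let xy : p _ (x : X 0) ord0 <= p _ (y : X 0) ord0 := ho_proj_le (cls ex ey).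

Lemma cocartesian_edge_exists (v : hom x z) :
  exists v' : hom y z, cmp v' (cls ex ey) = v.
Proof.
(* Face 1 is the long edge and face 2 is [e]; the value at 0 stands for the missing face and is
   arbitrary. *)
pose h (i : nat) : X 1 := if i == 1 then rep v else e.
have hh : horn 0 h.
  move=> k l kl k0 l0; have [-> ->] : k = 1 /\ l = 2 by lia.
  by rewrite /h /= ex rep_source.
have h01 : first_edge (h 2) = e.
  by rewrite /first_edge -[RHS]act_id; congr (act _ e); apply: mono_ext => i; apply: val_inj.
(* Arrows of [ord_cat 1] are inequalities: [xy] and [w] span the triangle of [simplex 1] over which
   the horn is filled. *)
have [t2 _ t1] := mono_triple_face xy w.
have hb : fills 0 (fun i => p _ (h i)) (mono_triple xy w : simplex 1 2).
  move=> [|[|[|i]]] // _ _; rewrite /face /=.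
    by rewrite t1; apply/esym/proj_edge; [apply: rep_source|apply: rep_target].
  by rewrite t2; apply/esym/proj_edge.
have [s hs _] := pe hh h01 hb.
have c : is_composite e (face 0 s) (rep v) by exists s; split=> //; apply: hs.
have [g1 _ g0] := is_composite_ends c.
rewrite ey rep_target in g1 g0.
exists (cls (esym g1) (esym g0)).
by rewrite (cls_cmp _ _ _ _ (rep_source v) (rep_target v) c); exact: repK.
Qed.

Lemma cls_composite (v : hom x z) (v' : hom y z) :
  cmp v' (cls ex ey) = v -> is_composite e (rep v') (rep v).
Proof.
move=> <-; have c := rep_cmp (cls ex ey) v'.
apply: composite_homotopic c; [|exact: composite_unit_r|exact: composite_unit_r].
exact/homotopic_sym/rep_cls.
Qed.

(** On the vertices [x, y, z, z], the triangles for [v] and [v'] are the faces 3 and 2 of a horn,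
    with common long edge [r]; its face 1 is the unit triangle on [r]. The face 0 of a filler is a
    homotopy between representatives of [v] and [v']. *)
Lemma cocartesian_edge_unique (v v' : hom y z) :
  cmp v (cls ex ey) = cmp v' (cls ex ey) -> v = v'.
Proof.
move=> /cls_composite [s3 [s32 s30 s31]].
have [s2 [s22 s20 s21]] := cls_composite (erefl (cmp v' (cls ex ey))).
set r := rep _ in s31 s21.
have [s1 [s12 s10 s11]] := composite_unit_r r.
have rz : face 0 r = z by apply: rep_target.
have rx : face 1 r = x by apply: rep_source.
pose h := tetra s1 s1 s2 s3.
have hh : horn 0 h.
  by move=> [|[|[|i]]] [|[|[|[|j]]]] //=; try lia;
     rewrite /h /= ?s32 ?s31 ?s22 ?s21 ?s12 ?s11.
have h01 : first_edge (h 3) = e.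
  by rewrite -s32; congr (act _ s3); apply: mono_ext => i; apply: val_inj;
     case: i => -[|[|]].
(* Here [uncoface] serves as the degeneracy sending 2 and 3 to 2, so that the last two vertices of
   [b] both lie under [z]. *)
pose d : mono 3 2 := uncoface 1 2.
pose b : simplex 1 3 := mono_comp (mono_triple xy w) d.
have zz : p _ (z : X 0) ord0 <= p _ (z : X 0) ord0 by [].
have hb : fills 0 (fun i => p _ (h i)) b.
  have xz := leq_trans xy w.
  move=> [|[|[|[|i]]]] // _ _; rewrite /face /=.
  - rewrite (@proj_triangle x z z s1 xz zz) ?s12 ?s10 ?face_degenerate //.
    by apply: mono_ext => -[[|[|[|//]]] hk].
  - rewrite (@proj_triangle x y z s2 xy w) ?s22 ?s20 ?rep_target //.
    by apply: mono_ext => -[[|[|[|//]]] hk].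
  - rewrite (@proj_triangle x y z s3 xy w) ?s32 ?s30 ?rep_target //.
    by apply: mono_ext => -[[|[|[|//]]] hk].
have [t ht _] := pe hh h01 hb.
rewrite -(repK (rep_source v) (rep_target v)) -(repK (rep_source v') (rep_target v')).
apply/cls_eqP; exists (face 0 t); split.
- by rewrite -(@face_face X 1 0 3) // ht // s30.
- by rewrite -(@face_face X 1 0 1) // ht //= s10 rz rep_target.
- by rewrite -(@face_face X 1 0 2) // ht // s20.
Qed.

End Cocartesian.

Lemma cocartesian_edge_arrow (x y : Ho X) (e : X 1) (ex : face 1 e = x) (ey : face 0 e = y) :
  cocartesian_edge p e -> cocartesian_arrow ho_proj (cls ex ey).
Proof.
move=> pe z v w _; have [v' vv'] := cocartesian_edge_exists ex ey pe w v.
exists v'; split; first by split=> //; apply: ord_hom_eq.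
move=> v'' [_ vv'']; apply: (cocartesian_edge_unique pe w (ex := ex) (ey := ey)).
by rewrite vv' vv''.
Qed.

Lemma ho_proj_cocartesian : infty_cocartesian_fibration p -> cocartesian_fibration ho_proj.
Proof.
move=> [_ pc] x b w.
have [|e [pe ex eb]] := pc x (mono_pair (w : p _ (x : X 0) ord0 <= b)).
  by apply: mono_ext => i; rewrite (ord1 i).
have ey : ho_proj (face 0 e : Ho X) = b.
  by rewrite /= /face smap_act eb.
exists (face 0 e : Ho X), ey, (cls ex erefl).
by split; [apply: cocartesian_edge_arrow|apply: ord_hom_eq].
Qed.

(** * Fibers over a vertex of the 1-simplex *)

Section Fiber.
Variable i : 'I_2.

(** A filler taken in [X] stays in the fiber, since membership is decided on vertices and each
    vertex lies on a given face. *)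
Lemma fiber_is_quasicategory : is_quasicategory (infty_fiber p i).
Proof.
move=> n k h hk hh.
have hh' : horn k (fun l => sval (h l)).
  by move=> l l' ll' lk lk'; have /(congr1 sval) := hh l l' ll' lk lk'.
have [y hy] := quasicategoryP hk hh'.
have yi : in_fiber p i y.
  apply: mono_ext => v.
  have [l [ln lk lv]] : exists l, [/\ l <= n.+2, l <> k & l <> v].
    (* Only [k] and [v] are forbidden, so three candidates suffice. *)
    pose good l := [&& l <= n.+2, l != k & l != v].
    suff : has good (iota 0 3).
      by move=> /hasP[l _ /and3P[? /eqP ? /eqP ?]]; exists l.
    by rewrite /= /good; lia.
  have vl : v = coface n.+1 l (uncoface n l v).
    apply: val_inj; have := ltn_ord v; rewrite /= /bump; case: ifP; lia.
  have := svalP (h l); rewrite -(hy l ln lk) /in_fiber /face smap_act.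
  by move=> /(congr1 (fun m : mono n.+1 1 => m (uncoface n l v))) => pv; rewrite {1}vl.
exists (exist _ y yi) => l ln lk; apply: sval_inj; exact: hy.
Qed.

Definition qfiber : quasicategory := QuasiCategory fiber_is_quasicategory.

Lemma in_fiber_edge (e : X 1) : in_fiber p i (face 1 e) -> in_fiber p i (face 0 e) ->
  in_fiber p i e.
Proof.
move=> e1 e0.
have ii : p _ (face 1 e) ord0 <= p _ (face 0 e) ord0 by rewrite e1 e0.
rewrite /in_fiber (proj_edge ii erefl erefl); apply: mono_ext.
by elim/ord2_cases; rewrite /= ?e1 ?e0.
Qed.

Lemma in_fiber_triangle (s : X 2) : in_fiber p i (face 2 s) -> in_fiber p i (face 0 s) ->
  in_fiber p i s.
Proof.
move=> s2 s0.
have p1 : p _ (face 1 (face 2 s)) ord0 = i by rewrite /face smap_act s2.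
have p0 : p _ (face 0 (face 2 s)) ord0 = i by rewrite /face smap_act s2.
have p2 : p _ (face 0 (face 0 s)) ord0 = i by rewrite /face smap_act s0.
have xy : p _ (face 1 (face 2 s)) ord0 <= p _ (face 0 (face 2 s)) ord0 by rewrite p0 p1.
have yz : p _ (face 0 (face 2 s)) ord0 <= p _ (face 0 (face 0 s)) ord0 by rewrite p0 p2.
rewrite /in_fiber (proj_triangle xy yz) //.
by apply: mono_ext => -[[|[|[|//]]] hk].
Qed.

Definition fiber_incl : smap qfiber X := ssub_incl _.

Lemma fiber_functor_ob (x : Ho qfiber) : ho_proj (Ho_map fiber_incl x) = i.
Proof. by rewrite /= (svalP (x : qfiber 0)). Qed.

Definition fiber_functor : functor (Ho qfiber) (fiber ho_proj i) :=
  @Functor (Ho qfiber) (fiber ho_proj i)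
    (fun x => exist _ (Ho_map fiber_incl x) (fiber_functor_ob x))
    (fun x y A => fmap (Ho_map fiber_incl) A)
    (fmap1 (Ho_map fiber_incl)) (fmapM (Ho_map fiber_incl)).

(** The functor is surjective on objects. It is full because an edge between vertices of the fiber
    lies in the fiber, and faithful because a homotopy between such edges does too. *)
Lemma fiber_functor_equivalence : cat_equivalence fiber_functor.
Proof.
apply: fully_faithful_equivalence => [[y yi]|x y v|x y u u'].
- have yf : in_fiber p i (y : X 0) by apply: mono_ext => k; rewrite (ord1 k).
  exists (exist _ (y : X 0) yf : qfiber 0).
  have -> : fiber_functor (exist _ (y : X 0) yf : qfiber 0) = exist _ y yi.
    exact: sval_inj.
  exists (idm _); exact: is_iso_id.
- have e1 : face 1 (rep (v : @hom (Ho X) _ _)) = sval (x : qfiber 0) by apply: rep_source.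
  have e0 : face 0 (rep (v : @hom (Ho X) _ _)) = sval (y : qfiber 0) by apply: rep_target.
  have ei : in_fiber p i (rep (v : @hom (Ho X) _ _)).
    by apply: in_fiber_edge; rewrite ?e1 ?e0; apply: svalP.
  pose e : qfiber 1 := exist _ _ ei.
  have ex : face 1 e = x by apply: sval_inj.
  have ey : face 0 e = y by apply: sval_inj.
  by exists (cls ex ey); rewrite -[fmap _ _]/(fmap (Ho_map fiber_incl) _) Ho_map_cls repK.
- have [ux [uy uE]] := Ho_map_rep fiber_incl u.
  have [ux' [uy' uE']] := Ho_map_rep fiber_incl u'.
  rewrite -[fmap _ u]/(fmap (Ho_map fiber_incl) u).
  rewrite -[fmap _ u']/(fmap (Ho_map fiber_incl) u').
  rewrite uE uE' => /cls_eqP [s [s2 s0 s1]].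
  rewrite -(repK (rep_source u) (rep_target u)) -(repK (rep_source u') (rep_target u')).
  apply/cls_eqP.
  have si : in_fiber p i s.
    apply: in_fiber_triangle; first by rewrite s2; apply: svalP (rep u).
    rewrite s0; exact: (in_fiber_act (mono_const 1 ord0) (svalP (face 0 (rep u)))).
  by exists (exist _ s si); split; apply: sval_inj.
Qed.

Lemma fiber_equivalence (Y : quasicategory) (h : smap Y qfiber) :
  qcat_equivalence h -> cat_equivalence (fcomp fiber_functor (Ho_map h)).
Proof.
move=> hh; apply: cat_equivalence_fcomp; first exact: Ho_map_equivalence.
exact: fiber_functor_equivalence.
Qed.

End Fiber.
End Fibration.

(** * Transport of the data defining the derived functor *)

(** Reconciles [infty_classified_by], with the simplex as right factor, and [sfun], with the simplex
    as left factor. *)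
Program Definition sprod_swap (X Y : sset) : smap (sprod X Y) (sprod Y X) :=
  @SMap (sprod X Y) (sprod Y X) (fun n x => (x.2, x.1)) _.

Section Fiber.
Variables (X : quasicategory) (p : smap X (simplex 1)) (i : 'I_2).
Variables (A : category) (S : sset) (M : marking A S) (Y : quasicategory).
Variables (T : smap S Y) (K : functor A (Ho Y)) (h : smap Y (qfiber p i)).

Lemma fiber_models : models M (scomp (ho_unit Y) T) K ->
  models M (scomp (ho_unit X) (scomp (ssub_incl _) (scomp h T)))
    (fcomp (full_incl _) (fcomp (fcomp (fiber_functor p i) (Ho_map h)) K)).
Proof.
move=> TK.
have := models_scomp TK (models_scomp (Ho_map_models h) (Ho_map_models (fiber_incl p i))).
exact.
Qed.

End Fiber.

Lemma collage_models (C D : category) (K : functor C D) (X : quasicategory)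
    (L : smap (nerve D) X) :
  models (nerve_marking C) (scomp (ho_unit X) (scomp L (nerve_map K)))
    (fcomp (Ho_of_nerve L) K).
Proof.
move=> a b u.
rewrite -[LHS]/(ho_unit X _ (L _ (nerve_map K _ (nerve_edge u)))) nerve_map_edge.
exact: ho_unit_edge.
Qed.

(** The cylinder [s] followed by the unit is an edge of a function complex, hence a natural
    transformation; its component at [c] is the class of a cocartesian edge. *)
Lemma classified_by_Ho (X C D : quasicategory) (p : smap X (simplex 1))
    (h0 : smap C (qfiber p ord0)) (h1 : smap D (qfiber p ord_max)) (g : smap C D) :
  infty_classified_by h0 h1 g ->
  classified_by (fcomp (fiber_functor p ord0) (Ho_map h0))
    (fcomp (fiber_functor p ord_max) (Ho_map h1)) (Ho_map g).
Proof.
move=> [e0 e1 [s [ps s0 s1 sc]]]; split.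
- exact: fiber_equivalence.
- exact: fiber_equivalence.
pose e : sfun C (nerve (Ho X)) 1 := scomp (ho_unit X) (scomp s (sprod_swap _ _)).
have fe1 : face 1 e = functor_vertex (scomp (ho_unit X) (scomp (ssub_incl _) h0)).
  apply: smap_ext => n [c x]; rewrite [c]ord1_mono_const.
  congr (ho_unit X _ _); rewrite -[RHS]s0 /=; congr (s _ (_, _)).
  by apply: mono_ext => k; apply: val_inj.
have fe0 : face 0 e = functor_vertex (scomp (ho_unit X) (scomp (ssub_incl _) (scomp h1 g))).
  apply: smap_ext => n [c x]; rewrite [c]ord1_mono_const.
  congr (ho_unit X _ _); rewrite -[RHS]s1 /=; congr (s _ (_, _)).
  by apply: mono_ext => k; apply: val_inj.
have m0 := fiber_models (T := smap_id C) h0 (@ho_unit_models C).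
have m1 := fiber_models h1 (Ho_map_models g).
have [|n nE] := edge_nattransP fe1 fe0 (M := ho_marking C) (K := fcomp (full_incl _)
  (fcomp (fiber_functor p ord0) (Ho_map h0))) _ m1.
  exact: m0.
exists n => c.
pose q := s _ (degenerate_edge (c : C 0), mono_id 1).
have nc : nerve_edge (n c) = ho_unit X _ q by apply: nE.
have q1 : face 1 q = sval (h0 _ (c : C 0)).
  rewrite -s0 /face -smap_act /=; congr (s _ (_, _)); first exact: face_degenerate.
  by apply: mono_ext => k; apply: val_inj; rewrite (ord1 k).
have q0 : face 0 q = sval (h1 _ (g _ (c : C 0))).
  rewrite -s1 /face -smap_act /=; congr (s _ (_, _)); first exact: face_degenerate.
  by apply: mono_ext => k; apply: val_inj; rewrite (ord1 k).
have -> : n c = cls (q1 : face 1 q = _ :> Ho X) (q0 : face 0 q = _ :> Ho X).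
  by apply: nerve_edge_inj; rewrite nc; apply: ho_unit_edge.
exact: cocartesian_edge_arrow (sc c).
Qed.

Theorem proposition4p7p1 (C D : category) (f : functor C D)
    (WC : subcat C) (WD : subcat D)
    (C' D' : quasicategory) (LC : smap (nerve C) C') (LD : smap (nerve D) D')
    (f' : smap C' D') :
  infty_localization (nerve_edges WC) LC ->
  infty_localization (nerve_edges WD) LD ->
  infty_left_derived_functor f WC WD LC LD f' ->
  left_derived_functor f WC WD (Ho_of_nerve LC) (Ho_of_nerve LD) (Ho_map f').
Proof.
move=> locC locD [_ _ [E' [LE [p [locE pLE pfib [h0 [h1 [n0 n1 clf]]]]]]]].
split; [exact: infty_localization_Ho|exact: infty_localization_Ho|].
exists (Ho E'), (Ho_of_nerve LE), (ho_proj p); split.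
- exact: infty_localization_Ho.
- exact: ho_proj_of_nerve.
- exact: ho_proj_cocartesian.
(* The map [h0] ends in the fiber of [p]; [fiber_functor] carries the homotopy category of that
   fiber to the fiber of [ho_proj p]. *)
exists (fcomp (fiber_functor p ord0) (Ho_map (h0 : smap C' (qfiber p ord0)))).
exists (fcomp (fiber_functor p ord_max) (Ho_map (h1 : smap D' (qfiber p ord_max)))).
split; last exact: classified_by_Ho.
- apply: (natural_equivalence_natiso (M := nerve_marking C)
    (natural_equivalence_scomp (ho_unit E') n0)); last exact: collage_models.
  exact: (fiber_models (h0 : smap C' (qfiber p ord0)) (Ho_of_nerve_models LC)).
apply: (natural_equivalence_natiso (M := nerve_marking D)
  (natural_equivalence_scomp (ho_unit E') n1)); last exact: collage_models.
exact: (fiber_models (h1 : smap D' (qfiber p ord_max)) (Ho_of_nerve_models LD)).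
Qed.
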